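(* Let $\theta>0$ and $p_k=\theta/(\theta+k-1)$, $k\ge1$. Consider any sequence of last-success problems with this profile of success probabilities, the $m$th problem having random number of trials $N^{(m)}$ with an arbitrary distribution on $\{0,1,2,\dots\}$, such that $N^{(m)}\to\infty$ in probability as $m\to\infty$. Then the probability that the strategy with single cutoff $e^{-1/\theta}$ stops at the last success converges to $e^{-1}$, and $e^{-1}$ is the asymptotically optimal winning probability, i.e. the supremum of the winning probability over all stopping strategies in the $m$th problem converges to $e^{-1}$ as $m\to\infty$.
   Context: Last-success problem with number of trials $N$: let $N,U_1,U_2,\dots$ be independent with $U_i$ uniform on $[0,1]$; $T_1<\dots<T_N$ are the ordered values of $U_1,\dots,U_N$ (the epochs of the trials). The trial at epoch $T_k$ is a success with probability $p_k$, independently of everything else. $\mathcal F_t$ is the $\sigma$-algebra generated by the epochs and outcomes of the trials on $[0,t]$. A stopping strategy is a random variable $\tau$ with values in $\{T_1,\dots,T_N,1\}$ with $\{\tau\le t\}\in\mathcal F_t$ for all $t\in[0,1]$; $\tau=1$ means not stopping. The strategy wins if $\tau=T_k$ for some $k$, the $k$th trial is a success and no later trial is a success. The strategy with single cutoff $b$ stops at the first success epoch $T_k$ with $T_k\ge b$ (and does not stop if there is none). $N^{(m)}\to\infty$ in probability means $\mathbb P(N^{(m)}\le K)\to0$ for every $K$. *)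

(* Defs.v *)
From HB Require Import structures.
From mathcomp Require Import all_boot all_order all_algebra.
From mathcomp Require Import all_classical all_reals all_analysis.

Set Implicit Arguments.
Unset Strict Implicit.
Unset Printing Implicit Defensive.

Import Order.TTheory GRing.Theory Num.Theory.
Import numFieldNormedType.Exports.

Local Open Scope classical_set_scope.
Local Open Scope ring_scope.

(* Independence of an arbitrary family of systems of events: the product rule
   holds along every finite subfamily [s]. *)
Definition mutually_independent (R : realType) (d : measure_display)
    (T : measurableType d) (P : probability T R) (I : eqType)
    (G : I -> set (set T)) : Prop :=
  forall (s : seq I) (E : I -> set T), uniq s ->
    (forall i, i \in s -> G i (E i)) ->
    P (\bigcap_(i in [set` s]) E i) = (\prod_(i <- s) P (E i))%E.

Definition sigma_of (d d' : measure_display) (T : measurableType d)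
    (T' : measurableType d') (X : T -> T') : set (set T) :=
  preimage_set_system setT X measurable.

(* Trials are numbered from 0 in chronological order, so [p k] and [outcome k]
   belong to the (k+1)-st trial.  [outcome k] is attached to the chronological
   rank and not to the index of the variable [unif i] that produces the epoch;
   only the outcomes of rank k < ntrials w are used.  In the independence axiom,
   [None] stands for the number of trials, [Some (inl i)] for [unif i] and
   [Some (inr k)] for [outcome k]. *)
Record last_success_problem (R : realType) (p : nat -> R) := LastSuccessProblem {
  disp : measure_display;
  Omega : measurableType disp;
  Pr : probability Omega R;
  ntrials : {RV Pr >-> nat};
  unif : nat -> {RV Pr >-> R};
  outcome : nat -> {RV Pr >-> bool};
  unif_itv : forall i w, unif i w \in `[0, 1];
  unif_law : forall i (A : set R), measurable A ->
    Pr (unif i @^-1` A) = uniform_prob (@ltr01 R) A;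
  outcome_law : forall k, Pr [set w | outcome k w] = (p k)%:E;
  all_independent : mutually_independent Pr
    (fun j : option (nat + nat) => match j with
       | None => sigma_of ntrials
       | Some (inl i) => sigma_of (unif i)
       | Some (inr k) => sigma_of (outcome k)
       end)
}.

Section LastSuccess.
Variables (R : realType) (p : nat -> R) (L : last_success_problem p).
Local Notation P := (Pr L).
Local Notation N := (ntrials L).
Local Notation X := (outcome L).

(* The (k+1)-st smallest of the first N variables; equals 1 for k >= N. *)
Definition epoch (k : nat) (w : Omega L) : R :=
  nth 1 (sort <=%R [seq unif L i w | i <- iota 0 (N w)]) k.

Definition trial_events (t : R) : set (set (Omega L)) :=
  [set A | exists (k : nat) (e : bool) (B : set R),
     [/\ measurable B, B `<=` `[0, t] &
       A = [set w | [/\ (k < N w)%N, B (epoch k w) & X k w = e]]]].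

Definition history (t : R) : set (set (Omega L)) := <<s trial_events t >>.

Definition stopping_strategy (tau : {RV P >-> R}) : Prop :=
  (forall w, (exists2 k, (k < N w)%N & tau w = epoch k w) \/ tau w = 1) /\
  (forall t : R, t \in `[0, 1] -> history t [set w | tau w <= t]).

Definition wins (tau : Omega L -> R) : set (Omega L) :=
  [set w | exists k, [/\ (k < N w)%N, tau w = epoch k w, X k w &
     forall j, (k < j < N w)%N -> ~~ X j w]].

Definition optimal_win_prob : \bar R :=
  ereal_sup [set P (wins tau) | tau in stopping_strategy].

(* When no trial qualifies, [find] returns N w, and [epoch (N w) w] is 1. *)
Definition single_cutoff (b : R) (w : Omega L) : R :=
  epoch (find (fun k => X k w && (b <= epoch k w)) (iota 0 (N w))) w.

End LastSuccess.

Arguments epoch {R p} L k w.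
Arguments trial_events {R p} L t A.
Arguments history {R p} L t A.
Arguments stopping_strategy {R p} L tau.
Arguments wins {R p} L tau.
Arguments single_cutoff {R p} L b w.

(* theta / (theta + k - 1) for k >= 1, renumbered from 0. *)
Definition theta_profile (R : realType) (theta : R) (k : nat) : R :=
  theta / (theta + k%:R).

Definition tends_to_infinity_in_probability (R : realType) (p : nat -> R)
    (L : nat -> last_success_problem p) : Prop :=
  forall K : nat,
    (fun m => Pr (L m) [set w | (ntrials (L m) w <= K)%N]) @ \oo --> 0%E.

(* Main.v *)
Require Import Defs.
From HB Require Import structures.
From mathcomp Require Import all_boot all_order all_algebra.
From mathcomp Require Import all_classical all_reals all_analysis measurable_realfun.
From mathcomp Require Import ring lra zify.

(** Write [single_success k d] for the probability that exactly one of the d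
    trials of ranks k, ..., k + d - 1 is a success.  When it is known that
    there are n trials, stopping at the first success of rank at least k wins
    with probability [single_success k (n - k)].  For the profile
    theta / (theta + k) the odds of a success at rank i >= 1 are theta / i, so
    that, for k >= 1,

      single_success k (n - k) = Q R,   R = sum of theta / i over k <= i < n,
                                        Q = product of (1 + theta / i)^-1.

    For k = x n and large n, R is close to - theta ln x and Q to exp (- R).
    Hence the value is close to R exp (- R), whose maximum exp (-1) is reached
    at R = 1, that is at x = exp (- 1 / theta).  This optimal fraction x does
    not depend on n, and about a fraction x of the trials have epochs below x:
    this is why the player loses nothing, in the limit, by not knowing the
    number of trials.  The two halves of the estimate of Q R are
    [single_success_le_eventually], uniform in k, and
    [single_success_ge_eventually].

    Upper bound.  A player who is told the number of trials and all the epochs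
    in advance does at least as well.  Just before rank k, this player knows
    the sigma-algebra [info k]; what any strategy has seen before the epoch of
    rank k lies in it ([history_trace], [info_stopped_before]), and the
    outcomes of rank at least k are independent of it ([prob_outcome]).
    Backward induction along the ranks, with the supersolution of the optimality
    equation given by [bellman_supersolution], bounds the winning probability
    of every strategy, on the event that there are n trials, by any upper bound
    on the numbers [single_success k (n - k)] ([prob_wins_ntrials_le]).

    Lower bound.  Let J be the number of trials with epochs below b.  The
    strategy with cutoff b wins as soon as exactly one trial of rank at least J
    is a success.  The number J is independent of the outcomes, and J / n is
    close to b by Chebyshev's inequality; hence
    [prob_single_cutoff_loses_le].

    Both bounds hold for every n beyond some K, so they survive averaging over
    the number of trials at the cost of the probability that there are at most
    K trials ([prob_le_tail]), which tends to 0.  The distribution of the number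
    of trials enters nowhere else. *)

Set Implicit Arguments.
Unset Strict Implicit.
Unset Printing Implicit Defensive.

Import Order.TTheory GRing.Theory Num.Theory.
Import numFieldNormedType.Exports.

Local Open Scope classical_set_scope.
Local Open Scope ring_scope.

(** * Independent trials observed in order *)

Section Profile.
Context {R : realType}.
Variable p : nat -> R.

(** The recursions condition on the outcome of the first of the d trials; this is
    also how these numbers are recognized as probabilities. *)
Fixpoint no_success (k d : nat) : R :=
  if d is d'.+1 then (1 - p k) * no_success k.+1 d' else 1.

Fixpoint single_success (k d : nat) : R :=
  if d is d'.+1
  then p k * no_success k.+1 d' + (1 - p k) * single_success k.+1 d'
  else 0.

Hypothesis p01 : forall k, 0 <= p k <= 1.

Lemma no_success_ge0 k d : 0 <= no_success k d.
Proof.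
elim: d k => [|d IH] k //=.
by rewrite mulr_ge0// subr_ge0; have /andP[] := p01 k.
Qed.

Hypothesis p_lt1 : forall k, p k.+1 < 1.

Lemma no_success_gt0 k d : 0 < no_success k.+1 d.
Proof.
elim: d k => [|d IH] k /=; first exact: ltr01.
by rewrite mulr_gt0// subr_gt0.
Qed.

(** The value of the problem with n known trials is the maximum of
    [single_success j (n - j)] over j >= k, but a supersolution of the
    optimality equation suffices for an upper bound and is easier to describe.
    Where the sum of the remaining odds is at most 1, that is where
    [single_success] is at most [no_success], stopping at the first success is
    right and v is [single_success]; at smaller ranks v is the constant c.  The
    sum of the odds grows as k decreases, so there is only one switch. *)
Lemma bellman_supersolution (c : R) (n : nat) :
  (forall k, (k <= n)%N -> single_success k (n - k) <= c) ->
  exists v : nat -> R, [/\ v 0%N <= c, 0 <= v n &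
    forall k, (k < n)%N -> v k.+1 <= v k /\
      p k * no_success k.+1 (n - k.+1) + (1 - p k) * v k.+1 <= v k].
Proof.
move=> hc.
pose v k := if single_success k (n - k) <= no_success k (n - k)
            then single_success k (n - k) else c.
exists v; split.
- by rewrite /v; case: ifP => // _; exact: hc.
- by rewrite /v subnn /= ler01.
move=> k kn.
have eqd : (n - k = (n - k.+1).+1)%N by lia.
have := hc k (ltnW kn); have := hc k.+1 kn.
rewrite /v eqd /=.
have := no_success_gt0 k (n - k.+1).
set q := no_success _ _; set h := single_success _ _.
move=> q0 hh1 hh2; have /andP[p0 p1] := p01 k.
(* At most one in odds after rank k: then [v k.+1] is [single_success]. *)
case: (leP h q) => hq.
  have H : h <= p k * q + (1 - p k) * h by nra.
  by case: ifP => _; split => //; exact: le_trans H hh2.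
(* Otherwise the odds from rank k on exceed 1 as well: both values are c. *)
have -> : (p k * q + (1 - p k) * h <= (1 - p k) * q) = false.
  apply/negbTE; rewrite -ltNge.
  have [->|pn0] := eqVneq (p k) 0; first by lra.
  have : 0 < p k by rewrite lt0r pn0.
  by nra.
by split => //; nra.
Qed.

End Profile.

(** * The profile theta / (theta + k) *)

Section ThetaProfile.
Context {R : realType}.
Variable theta : R.
Hypothesis theta_gt0 : 0 < theta.
Local Notation p := (theta_profile theta).

Lemma theta_profile01 k : 0 <= p k <= 1.
Proof.
have t0 := theta_gt0.
have k0 : 0 <= k%:R :> R by [].
have tk : 0 < theta + k%:R by lra.
by rewrite /theta_profile divr_ge0 ?(ltW tk) ?(ltW theta_gt0)// ler_pdivrMr//; lra.
Qed.

Lemma theta_profile_lt1 k : p k.+1 < 1.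
Proof.
have t0 := theta_gt0.
have k0 : 0 < k.+1%:R :> R by rewrite ltr0n.
by rewrite /theta_profile ltr_pdivrMr; lra.
Qed.

(** The odds of the profile are [theta / i].  Rank 0 is excluded: its success is
    certain, so its odds are infinite. *)
Lemma single_successE k d : single_success p k.+1 d =
  no_success p k.+1 d * \sum_(k.+1 <= i < k.+1 + d) theta / i%:R.
Proof.
have t0 := theta_gt0.
elim: d k => [|d IH] k /=; first by rewrite addn0 big_geq ?mulr0.
rewrite IH big_ltn; last by lia.
rewrite -addSnnS; set q := no_success _ _ _; set s := \sum_(_ <= _ < _) _.
rewrite /theta_profile.
have k0 : 0 < k.+1%:R :> R by rewrite ltr0n.
move: (k.+1%:R) k0 => x x0.
by field; apply/andP; split; apply: lt0r_neq0; lra.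
Qed.

Lemma no_success_le_expR k d :
  no_success p k d <= expR (- \sum_(k <= i < k + d) p i).
Proof.
have t0 := theta_gt0.
elim: d k => [|d IH] k /=; first by rewrite addn0 big_geq// oppr0 expR0.
rewrite big_ltn; last by lia.
rewrite opprD expRD -addSnnS ler_pM//.
- by have := theta_profile01 k; lra.
- exact/no_success_ge0/theta_profile01.
- by have := expR_ge1Dx (- p k); lra.
Qed.

(** Here 1 - p i is the inverse of 1 + theta / i, which is at most
    exp (theta / i). *)
Lemma no_success_ge_expR k d :
  expR (- \sum_(k.+1 <= i < k.+1 + d) theta / i%:R) <= no_success p k.+1 d.
Proof.
have t0 := theta_gt0.
elim: d k => [|d IH] k /=; first by rewrite addn0 big_geq// oppr0 expR0.
rewrite big_ltn; last by lia.
rewrite opprD expRD -addSnnS ler_pM ?expR_ge0//.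
have k0 : 0 < k.+1%:R :> R by rewrite ltr0n.
have -> : 1 - p k.+1 = (1 + theta / k.+1%:R)^-1.
  rewrite /theta_profile; move: (k.+1%:R) k0 => x x0.
  by field; apply/andP; split; apply: lt0r_neq0; lra.
rewrite expRN lef_pV2 ?posrE ?expR_gt0 ?expR_ge1Dx//.
by rewrite addr_gt0// divr_gt0.
Qed.

Lemma ln_succ_bounds k : k.+2%:R^-1 <= ln (k.+2%:R : R) - ln k.+1%:R <= k.+1%:R^-1.
Proof.
have k1 : 0 < k.+1%:R :> R by rewrite ltr0n.
have k2 : 0 < k.+2%:R :> R by rewrite ltr0n.
have e : k.+2%:R = k.+1%:R + 1 :> R by rewrite -natr1.
rewrite -ln_div ?posrE//; apply/andP; split; last first.
  have -> : k.+2%:R / k.+1%:R = 1 + k.+1%:R^-1 :> R.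
    by rewrite e; field; rewrite gt_eqF.
  by apply: le_ln1Dx; rewrite (lt_trans (ltrN10 _)) ?invr_gt0.
have -> : k.+2%:R / k.+1%:R = (1 + - k.+2%:R^-1)^-1 :> R.
  by rewrite e; field; rewrite !gt_eqF//=; lra.
have h : k.+2%:R^-1 < 1 :> R by rewrite invf_lt1// ltr1n.
move: (k.+2%:R^-1) h => u u1.
rewrite lnV ?posrE ?subr_gt0//.
have : -1 < - u by rewrite ltrN2.
by move/le_ln1Dx; lra.
Qed.

Lemma harmonic_ge_ln k d :
  ln ((k.+1 + d)%:R : R) - ln k.+1%:R <= \sum_(k.+1 <= i < k.+1 + d) i%:R^-1.
Proof.
elim: d => [|d IH]; first by rewrite addn0 big_geq// subrr.
rewrite addnS big_nat_recr/=; last by lia.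
have /andP[_] := ln_succ_bounds (k + d); move: IH; rewrite !addSn.
by move: (ln _) (ln _) (ln _) (_^-1) (\sum_(_ <= _ < _) _) => a b c e f; lra.
Qed.

(** Each term exceeds the increment of ln by at most 1 / i - 1 / (i + 1), and
    these corrections telescope. *)
Lemma harmonic_le_ln k d :
  \sum_(k.+1 <= i < k.+1 + d) i%:R^-1
    <= ln ((k.+1 + d)%:R : R) - ln k.+1%:R + k.+1%:R^-1 - (k.+1 + d)%:R^-1.
Proof.
elim: d => [|d IH]; first by rewrite addn0 big_geq// subrr add0r subrr.
rewrite addnS big_nat_recr/=; last by lia.
have /andP[+ _] := ln_succ_bounds (k + d); move: IH; rewrite !addSn.
move: (ln _) (ln _) (ln _) (\sum_(_ <= _ < _) _) => a b c f.
by move: (k.+1%:R^-1) ((k + d).+1%:R^-1) ((k + d).+2%:R^-1) => u v w; lra.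
Qed.

(** Since i + 1 <= 2 i, the term 1 / i^2 is at most twice 1 / i - 1 / (i + 1), and
    the sum telescopes. *)
Lemma sum_inv_sq_le k d :
  \sum_(k.+1 <= i < k.+1 + d) (i%:R ^+ 2)^-1
    <= 2 * (k.+1%:R^-1 - (k.+1 + d)%:R^-1) :> R.
Proof.
elim: d => [|d IH]; first by rewrite addn0 big_geq// subrr mulr0.
rewrite addnS big_nat_recr/=; last by lia.
apply: (le_trans (lerD IH (lexx _))).
move: (k.+1 + d)%N (leq_addr d k.+1) => m km.
have m1 : 1 <= m%:R :> R by rewrite ler1n; lia.
suff : (m%:R ^+ 2)^-1 <= 2 * (m%:R^-1 - m.+1%:R^-1) :> R.
  by move: (k.+1%:R^-1) (m%:R^-1) (m.+1%:R^-1) (_^-1) => u v w y; lra.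
rewrite -(natr1 m); move: (m%:R) m1 => x x1; have x0 : 0 < x by lra.
have -> : 2 * (x^-1 - (x + 1)^-1) = 2 / (x * (x + 1)).
  by field; apply/andP; split; apply: lt0r_neq0; lra.
rewrite ler_pdivlMr; last by rewrite mulr_gt0//; lra.
have -> : (x ^+ 2)^-1 * (x * (x + 1)) = 1 + x^-1 by field; exact: lt0r_neq0.
by have : x^-1 <= 1; [rewrite invf_le1|lra].
Qed.

Lemma mulr_expRN_le (x : R) : x * expR (- x) <= expR (-1).
Proof.
have -> : -1 = (x - 1) + - x by ring.
rewrite expRD ler_wpM2r ?expR_ge0//.
by have := expR_ge1Dx (x - 1); lra.
Qed.

Let alpha := theta / (theta + 1).

(** Write Q R for the value, as in [single_successE], and S for the sum of the
    p i.  Then Q <= exp (- S), so Q S <= exp (-1), and it remains to bound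
    Q (R - S).  Here R - S is at most a constant times 1 / k, while p i is at
    least alpha / i, whence Q <= (k / n)^alpha; as alpha <= 1, the quotient Q / k
    is at most n^(- alpha).  This makes the error uniform in k. *)
Lemma single_success_le n k : (0 < n)%N -> (k <= n)%N ->
  single_success p k (n - k)
    <= expR (-1) + (2 * theta ^+ 2 + 1) * expR (- (alpha * ln n%:R)).
Proof.
have t0 := theta_gt0.
have a0 : 0 < alpha by rewrite divr_gt0//; lra.
have a1 : alpha <= 1 by rewrite ler_pdivrMr; lra.
have nosuc j m : no_success p j.+1 m <=
    expR (- (alpha * (ln (j.+1 + m)%:R - ln j.+1%:R))).
  apply: (le_trans (no_success_le_expR _ _)).
  rewrite ler_expR lerN2.
  apply: (@le_trans _ _ (alpha * \sum_(j.+1 <= i < j.+1 + m) i%:R^-1)).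
    by rewrite ler_pM2l ?harmonic_ge_ln.
  rewrite mulr_sumr ler_sum_nat// => i /andP[ji _].
  have i1 : 1 <= i%:R :> R by rewrite ler1n; lia.
  rewrite /alpha /theta_profile -mulrA ler_pM2l// -invfM.
  have h : theta * 1 <= theta * i%:R by rewrite ler_pM2l.
  by rewrite lef_pV2 ?posrE; [|apply: mulr_gt0|]; lra.
case: n => // n _; case: k => [|k] kn.
  (* The first trial succeeds, so the value is the probability of no success
     from rank 1 on. *)
  rewrite subn0 /= /theta_profile addr0 divff ?gt_eqF// subrr mul0r addr0 mul1r.
  have := nosuc 0%N n; rewrite ln1 subr0 add1n => h.
  have e1 := expR_gt0 (-1 : R); have e2 := expR_gt0 (- (alpha * ln n.+1%:R)).
  have := mulr_ge0 (sqr_ge0 theta) (ltW e2); lra.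
set d := (n.+1 - k.+1)%N; have eN : n.+1 = (k.+1 + d)%N by rewrite /d; lia.
rewrite single_successE.
pose S := \sum_(k.+1 <= i < k.+1 + d) p i.
set T := \sum_(_ <= _ < _) _.
have TS : T - S <= theta ^+ 2 * (2 * k.+1%:R^-1).
  apply: (@le_trans _ _ (theta ^+ 2 * \sum_(k.+1 <= i < k.+1 + d) (i%:R ^+ 2)^-1)).
    rewrite mulr_sumr /T /S -sumrB ler_sum_nat// => i /andP[ji _].
    have i1 : 1 <= i%:R :> R by rewrite ler1n; lia.
    rewrite /theta_profile.
    have -> : theta / i%:R - theta / (theta + i%:R) =
        theta ^+ 2 * (i%:R * (theta + i%:R))^-1.
      by field; rewrite !gt_eqF//; lra.
    by rewrite ler_pM2l ?exprn_gt0// lef_pV2 ?posrE; nra.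
  rewrite ler_pM2l ?exprn_gt0//; apply: (le_trans (sum_inv_sq_le _ _)).
  by rewrite ler_pM2l// gerBl invr_ge0.
have Q0 := no_success_gt0 theta_profile_lt1 k d.
have QS := no_success_le_expR k.+1 d.
have Qa := nosuc k d.
have S0 : 0 <= S by apply: sumr_ge0 => i _; have /andP[] := theta_profile01 i.
have h1 : no_success p k.+1 d * S <= expR (-1).
  apply: le_trans (mulr_expRN_le S); rewrite mulrC ler_wpM2l//.
have h2 : no_success p k.+1 d * k.+1%:R^-1 <= expR (- (alpha * ln n.+1%:R)).
  have k1 : 0 < k.+1%:R :> R by rewrite ltr0n.
  rewrite ler_pdivrMr//; apply: (le_trans Qa).
  rewrite -[X in _ <= _ * X]lnK ?posrE// -expRD ler_expR -eN.
  have : 0 <= ln k.+1%:R :> R by rewrite ln_ge0// ler1n.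
  by nra.
have E0 := expR_gt0 (- (alpha * ln n.+1%:R)).
have -> : no_success p k.+1 d * T =
  no_success p k.+1 d * S + no_success p k.+1 d * (T - S) by ring.
have h3 : no_success p k.+1 d * (T - S) <=
    2 * theta ^+ 2 * (no_success p k.+1 d * k.+1%:R^-1).
  by have := ler_wpM2l (ltW Q0) TS; move: (k.+1%:R^-1) => u; lra.
have h4 : 2 * theta ^+ 2 * (no_success p k.+1 d * k.+1%:R^-1) <=
  2 * theta ^+ 2 * expR (- (alpha * ln n.+1%:R)).
  by rewrite ler_wpM2l// mulr_ge0// sqr_ge0.
apply: (le_trans (lerD h1 (le_trans h3 h4))).
by rewrite lerD2l ler_wpM2r ?(ltW E0)// lerDl.
Qed.

Lemma single_success_le_eventually (eps : R) : 0 < eps ->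
  exists n0, forall n k, (n0 <= n)%N -> (k <= n)%N ->
    single_success p k (n - k) <= expR (-1) + eps.
Proof.
move=> e0; have t0 := theta_gt0.
have a0 : 0 < alpha by rewrite divr_gt0//; lra.
have C0 : 0 < 2 * theta ^+ 2 + 1 by have := sqr_ge0 theta; lra.
pose M := expR (alpha^-1 * - ln ((2 * theta ^+ 2 + 1)^-1 * eps)).
exists (Num.trunc M).+1 => n k n0n kn.
have nM : M <= n%:R.
  by rewrite (le_trans (ltW (truncnS_gt M)))// ler_nat.
apply: (le_trans (single_success_le _ kn)); first by lia.
rewrite lerD2l -ler_pdivlMl//.
rewrite -[leRHS]lnK ?posrE ?mulr_gt0 ?invr_gt0// ler_expR lerNl -ler_pdivrMl//.
by rewrite -[leLHS]expRK ler_ln ?posrE ?expR_gt0//; apply: lt_le_trans nM; exact: expR_gt0.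
Qed.

(** Let T be the sum of the odds from rank k on.  The value is at least
    T exp (- T), and exp (- T) >= exp (-1) (2 - T) turns this into
    exp (-1) (1 - (T - 1)^2).  When k / n is close to b = exp (- 1 / theta), T is
    close to - theta ln b = 1. *)
Lemma single_success_ge_eventually (eps : R) : 0 < eps ->
  exists2 delta, 0 < delta & exists n0, forall n k, (n0 <= n)%N -> (k <= n)%N ->
    `|k%:R - n%:R * expR (- (1 / theta))| < n%:R * delta ->
    expR (-1) - eps <= single_success p k (n - k).
Proof.
move=> e0; have t0 := theta_gt0; set b := expR _.
have b0 : 0 < b by exact: expR_gt0.
pose eta := Num.min 1 eps.
have [h0 h1 heps] : [/\ 0 < eta, eta <= 1 & eta <= eps].
  by rewrite /eta lt_min ltr01 e0 !ge_min !lexx orbT.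
have /cvgrPdist_lt /(_ (eta / (2 * theta))) := continuous_ln b0.
have th0 : 0 < eta / (2 * theta) by rewrite divr_gt0// mulr_gt0.
move=> /(_ th0) /nbhs_ballP[/= d1 d10 Hd1].
(* The bound b / 2 keeps k proportional to n, so that the difference between
   the harmonic sum and the logarithm, of order 1 / k, vanishes. *)
pose delta := Num.min d1 (b / 2).
have [dl0 dl1 dlb] : [/\ 0 < delta, delta <= d1 & delta <= b / 2].
  by rewrite /delta lt_min d10 divr_gt0//= !ge_min !lexx orbT.
exists delta => //.
pose M := 4 * theta / (b * eta).
exists (Num.trunc M).+1 => n k n0n kn dist.
have n1 : 0 < n%:R :> R by rewrite ltr0n (leq_trans _ n0n).
have nM : M <= n%:R.
  by rewrite (le_trans (ltW (truncnS_gt M)))// ler_nat.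
have kb : n%:R * (b / 2) <= k%:R.
  have : n%:R * delta <= n%:R * (b / 2) by rewrite ler_pM2l.
  by move: dist; rewrite ltr_norml => /andP[]; lra.
have k0 : 0 < k%:R :> R by apply: lt_le_trans kb; rewrite mulr_gt0// divr_gt0.
case: k kn dist kb k0 => [|k] kn dist kb k0; first by rewrite ltxx in k0.
set d := (n - k.+1)%N; have eN : n = (k.+1 + d)%N by rewrite subnKC.
rewrite single_successE.
set T := \sum_(_ <= _ < _) _.
have T0 : 0 <= T by apply: sumr_ge0 => i _; rewrite divr_ge0// ltW.
have hT : T = theta * \sum_(k.+1 <= i < k.+1 + d) i%:R^-1 by rewrite mulr_sumr.
have Tge : theta * (ln n%:R - ln k.+1%:R) <= T.
  by rewrite hT ler_pM2l// {1}eN; exact: harmonic_ge_ln.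
have Tle : T <= theta * (ln n%:R - ln k.+1%:R) + theta * k.+1%:R^-1.
  rewrite hT -mulrDr ler_pM2l//; apply: (le_trans (harmonic_le_ln k d)).
  by rewrite -eN lerBlDr lerDl invr_ge0.
have kinv : theta * k.+1%:R^-1 <= eta / 2.
  rewrite ler_pdivrMr//.
  move: nM; rewrite /M ler_pdivrMr ?mulr_gt0// => nM.
  have := ler_wpM2l (ltW h0) kb; lra.
have : `|k.+1%:R / n%:R - b| < d1.
  have -> : k.+1%:R / n%:R - b = (k.+1%:R - n%:R * b) / n%:R.
    by move: (k.+1%:R) => x; field; rewrite gt_eqF.
  rewrite normrM normfV (gtr0_norm n1) ltr_pdivrMr//.
  by apply: (lt_le_trans dist); rewrite mulrC ler_pM2r.
rewrite distrC => /Hd1.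
rewrite ltr_pdivlMr ?mulr_gt0// ln_div ?posrE// expRK.
set D := - _ - _ => hD.
have eD : theta * (ln n%:R - ln k.+1%:R) - 1 = theta * D.
  rewrite /D; move: (ln _) (ln _) => x y; field; exact: lt0r_neq0.
have hD2 : `|theta * D| < eta / 2 by rewrite normrM gtr0_norm//; lra.
have T1 : (T - 1) ^+ 2 <= eta.
  have : `|T - 1| <= eta.
    move: Tge Tle kinv hD2; rewrite -eD.
    move: (theta * (_ - _)) (theta * _^-1) => A B hA hAB hB.
    rewrite ltr_norml => /andP[hl hr].
    by rewrite ler_norml; apply/andP; split; lra.
  rewrite -real_normK ?num_real// => h.
  by have := normr_ge0 (T - 1); nra.
have hQ := no_success_ge_expR k d.
apply: (@le_trans _ _ (expR (- T) * T)); last by rewrite ler_wpM2r.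
have -> : - T = -1 + (1 - T) by ring.
rewrite expRD.
have E1 : expR (-1) <= 1 :> R by rewrite -[leRHS]expR0 ler_expR; lra.
have E0 := expR_gt0 (-1 : R).
have E2 := expR_ge1Dx (1 - T).
apply: (@le_trans _ _ (expR (-1) * (2 - T) * T)).
  have -> : expR (-1) * (2 - T) * T = expR (-1) - expR (-1) * (T - 1) ^+ 2 by ring.
  rewrite lerD2l lerN2; apply: (@le_trans _ _ (1 * (T - 1) ^+ 2)).
    by rewrite ler_wpM2r// sqr_ge0.
  by lra.
by rewrite ler_wpM2r// ler_pM2l//; lra.
Qed.

End ThetaProfile.

(** * Sigma-algebras and real-valued probabilities *)

Section SigmaAlgebra.
Context {T : Type} (G : set (set T)).
Hypothesis sG : sigma_algebra setT G.

(** The closure properties are stated for a bare system of sets because several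
    sigma-algebras on one sample space are used together. *)
Lemma sigma_algebraC A : G A -> G (~` A).
Proof. by case: sG => _ h _ /h; rewrite setTD. Qed.

Lemma sigma_algebra_bigcup (F : (set T)^nat) :
  (forall n, G (F n)) -> G (\bigcup_n F n).
Proof. by case: sG => _ _; exact. Qed.

Lemma sigma_algebraU A B : G A -> G B -> G (A `|` B).
Proof.
move=> GA GB; rewrite -bigcup2E; apply: sigma_algebra_bigcup => -[|[|n]]//=.
by case: sG.
Qed.

Lemma sigma_algebraI A B : G A -> G B -> G (A `&` B).
Proof.
move=> GA GB; rewrite -[A `&` B]setCK setCI.
by apply: sigma_algebraC; apply: sigma_algebraU; exact: sigma_algebraC.
Qed.

Lemma sigma_algebraD A B : G A -> G B -> G (A `\` B).
Proof. by move=> GA GB; apply: sigma_algebraI => //; exact: sigma_algebraC. Qed.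

Lemma sigma_algebra0 : G set0. Proof. by case: sG. Qed.

Lemma sigma_algebraT : G setT.
Proof. by rewrite -setC0; apply: sigma_algebraC; case: sG. Qed.

Lemma sigma_algebra_prop (Q : Prop) : G [set _ | Q].
Proof.
have [q|q] := pselect Q.
  rewrite (_ : [set _ | _] = setT); first exact: sigma_algebraT.
  by apply/seteqP; split.
rewrite (_ : [set _ | _] = set0); first exact: sigma_algebra0.
by apply/seteqP; split.
Qed.

Lemma sigma_algebra_bigcup_count (I : countType) (F : I -> set T) :
  (forall i, G (F i)) -> G [set w | exists i, F i w].
Proof.
move=> GF.
rewrite (_ : [set w | _] =
  \bigcup_n (if unpickle n is Some i then F i else set0)).
  by apply: sigma_algebra_bigcup => n; case: unpickle => [i|]//; case: sG.
apply/seteqP; split => w /=.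
  by move=> [i Fi]; exists (pickle i) => //; rewrite pickleK.
by move=> [n _]; case: unpickle => [i|]// Fi; exists i.
Qed.

Lemma sigma_algebra_preimage_real (R : realType) (f : T -> R) :
  (forall t, G [set w | t < f w]) ->
  forall B, measurable B -> G (f @^-1` B).
Proof.
move=> Gf B mB.
have : image_set_system setT f G B.
  have : (@RGenOInfty.G R).-sigma.-measurable B.
    by rewrite -RGenOInfty.measurableE.
  move: {mB} B; apply: smallest_sub; first exact: sigma_algebra_image.
  move=> _ [t ->]; rewrite /image_set_system /= setTI.
  rewrite (_ : _ @^-1` _ = [set w | t < f w])//.
  by apply/seteqP; split => w /=; rewrite in_itv /= andbT.
by rewrite /image_set_system /= setTI.
Qed.

Lemma sigma_algebra_count_lt (I : Type) (Q : I -> T -> bool) :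
  (forall i, G [set w | Q i w]) ->
  forall s m, G [set w | (count (Q^~ w) s < m)%N].
Proof.
move=> GQ; elim=> [|i s IH] m /=; first exact: sigma_algebra_prop.
case: m => [|m].
  rewrite (_ : [set w | _] = set0); first by case: sG.
  by apply/seteqP; split.
rewrite (_ : [set w | _] = ([set w | Q i w] `&` [set w | (count (Q^~ w) s < m)%N])
  `|` (~` [set w | Q i w] `&` [set w | (count (Q^~ w) s < m.+1)%N])).
  by apply: sigma_algebraU; apply: sigma_algebraI => //; exact: sigma_algebraC.
apply/seteqP; split => w /=.
  by case: (Q i w) => /= h; [left|right]; split.
by case=> -[]; case: (Q i w).
Qed.

Lemma sigma_algebra_count_eq (I : Type) (Q : I -> T -> bool) :
  (forall i, G [set w | Q i w]) ->
  forall s m, G [set w | count (Q^~ w) s = m].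
Proof.
move=> GQ s m.
rewrite (_ : [set w | _] = [set w | (count (Q^~ w) s < m.+1)%N] `\`
   [set w | (count (Q^~ w) s < m)%N]).
  by apply: sigma_algebraD; exact: sigma_algebra_count_lt.
by apply/seteqP; split => w /=; [move=> ->; split; rewrite ?ltnn|
  move=> [h1 /negP h2]; lia].
Qed.

End SigmaAlgebra.

Section RealProbability.
Context d (T : measurableType d) (R : realType) (P : probability T R).
Implicit Types A B : set T.

(** Real-valued so that ordered-field arithmetic applies; it agrees with P on
    measurable sets, by [probE]. *)
Definition prob A : R := fine (P A).

Lemma probE A : measurable A -> P A = (prob A)%:E.
Proof. by move=> mA; rewrite /prob fineK// fin_num_measure. Qed.

Lemma prob_ge0 A : 0 <= prob A.
Proof. by rewrite fine_ge0. Qed.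

Lemma prob_set0 : prob set0 = 0.
Proof. by rewrite /prob measure0. Qed.

Lemma prob_setT : prob setT = 1.
Proof. by rewrite /prob probability_setT. Qed.

Lemma le_prob A B : measurable A -> measurable B -> A `<=` B -> prob A <= prob B.
Proof.
by move=> mA mB AB; rewrite -lee_fin -!probE// le_measure ?inE.
Qed.

Lemma probDI A B : measurable A -> measurable B ->
  prob A = prob (A `\` B) + prob (A `&` B).
Proof.
move=> mA mB; apply: EFin_inj; rewrite EFinD -!probE//; last first.
- exact: measurableD.
- exact: measurableI.
exact: measureDI.
Qed.

Lemma probU_le A B : measurable A -> measurable B ->
  prob (A `|` B) <= prob A + prob B.
Proof.
move=> mA mB; rewrite -lee_fin EFinD -!probE//; last exact: measurableU.
exact: measureU2.
Qed.

Lemma probU A B : measurable A -> measurable B -> A `&` B = set0 ->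
  prob (A `|` B) = prob A + prob B.
Proof.
move=> mA mB AB; apply: EFin_inj; rewrite EFinD -!probE//; last exact: measurableU.
exact: measureU.
Qed.

Lemma probC A : measurable A -> prob (~` A) = 1 - prob A.
Proof.
move=> mA; apply: EFin_inj; rewrite EFinB -!probE//; last exact: measurableC.
exact: probability_setC.
Qed.

Lemma prob_bigU_le (I : Type) (s : seq I) (F : I -> set T) :
  (forall i, measurable (F i)) ->
  prob (\big[setU/set0]_(i <- s) F i) <= \sum_(i <- s) prob (F i).
Proof.
move=> mF; elim: s => [|i s IH]; first by rewrite !big_nil prob_set0.
rewrite !big_cons; apply: le_trans (probU_le _ _) _ => //.
  exact: bigsetU_measurable.
by rewrite lerD2l.
Qed.

(** The law of total probability: a comparison of A with B may be made
    conditionally on the value of f. *)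
Lemma prob_by_value (f : T -> nat) A B c : 0 <= c ->
  (forall n, measurable [set w | f w = n]) -> measurable A -> measurable B ->
  (forall n, prob (A `&` [set w | f w = n]) <= c * prob (B `&` [set w | f w = n])) ->
  prob A <= c * prob B.
Proof.
move=> c0 mf mA mB h.
have slice C : measurable C ->
    P C = (\sum_(n <oo) P (C `&` [set w | f w = n]))%E.
  move=> mC.
  have e : C = \bigcup_n (C `&` [set w | f w = n]).
    by apply/seteqP; split => [w Cw|w [n _ []]//]; exists (f w).
  rewrite {1}e measure_semi_bigcup//.
  - by move=> i; exact: measurableI.
  - by move=> i j _ _ [w [/= [_ <-] [_ <-]]].
  - by rewrite -e.
rewrite -lee_fin EFinM -!probE// slice// (slice B)// -nneseriesZl//.
apply: lee_nneseries => // n _ /=.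
rewrite !probE; [by rewrite -EFinM lee_fin|exact: measurableI..].
Qed.

End RealProbability.

(** * Independence and the information available before a rank *)

Section Cylinders.
Context d (T : measurableType d) (R : realType) (P : probability T R).
Context (I : choiceType) (G : I -> set (set T)).

(** The pi-system that generates the sigma-algebra of the sources indexed by D. *)
Definition cylinders (D : {pred I}) : set (set T) :=
  [set A | exists (s : seq I) (E : I -> set T),
     [/\ uniq s, {subset s <= D}, (forall i, i \in s -> G i (E i)) &
         A = \bigcap_(i in [set` s]) E i]].

Hypothesis GT : forall i, G i setT.
Hypothesis GI : forall i, setI_closed (G i).
Hypothesis Gm : forall i, G i `<=` measurable.
Hypothesis indG : mutually_independent P G.

Lemma cylinders_setI D : setI_closed (cylinders D).
Proof.
move=> _ _ [s1 [E1 [_ D1 G1 ->]]] [s2 [E2 [_ D2 G2 ->]]].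
pose E i := (if i \in s1 then E1 i else setT) `&` (if i \in s2 then E2 i else setT).
exists (undup (s1 ++ s2)), E; split.
- exact: undup_uniq.
- by move=> i; rewrite mem_undup mem_cat => /orP[/D1|/D2].
- move=> i _; apply: GI; case: ifPn => // h; [exact: G1|exact: G2].
apply/seteqP; split => w.
  by move=> [h1 h2] i _; split; case: ifPn => // hi; [exact: h1|exact: h2].
move=> h; split => i /= hi; have := h i; rewrite /= mem_undup mem_cat hi ?orbT.
  by move=> /(_ isT) []; rewrite hi.
by move=> /(_ isT) []; rewrite hi.
Qed.

Lemma cylinders_setT D : cylinders D setT.
Proof.
exists [::], (fun=> setT); split => //.
by apply/seteqP; split.
Qed.

Lemma cylinders_source (D : {pred I}) i A : i \in D -> G i A -> cylinders D A.
Proof.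
move=> Di GA; exists [:: i], (fun=> A); split => //.
- by move=> j; rewrite inE => /eqP ->.
- by move=> j; rewrite inE => /eqP ->.
- by apply/seteqP; split => w => [h j _|]//; apply; rewrite /= inE.
Qed.

Lemma cylinders_measurable D : cylinders D `<=` measurable.
Proof.
move=> _ [s [E [_ _ GE ->]]].
rewrite bigcap_seq big_seq.
by elim/big_ind: _ => // [A B mA mB|i /GE /Gm//]; exact: measurableI.
Qed.

(** As functions of A, both sides are finite measures; by the product rule they
    agree on the pi-system of cylinders, hence on what it generates. *)
Lemma cylinders_independent (D : {pred I}) i A B :
  <<s cylinders D >> A -> i \notin D -> G i B -> prob P (A `&` B) = prob P A * prob P B.
Proof.
move=> sA Di GB.
have mB : measurable B := Gm GB.
have sm : <<s cylinders D >> `<=` measurable.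
  by apply: smallest_sub; [exact: sigma_algebra_measurable|exact: cylinders_measurable].
have mA : measurable A := sm _ sA.
apply: EFin_inj; rewrite EFinM -!probE//; last exact: measurableI.
rewrite muleC [X in (X * _)%E]probE//.
pose c := NngNum (prob_ge0 P B).
rewrite -[LHS]/(mrestr P mB A) -[RHS]/(mscale c P A).
have -> // := @g_sigma_algebra_measure_unique _ R T (cylinders D) _ (fun=> setT)
  _ _ (mrestr P mB : {measure set T -> \bar R}) (mscale c P : {measure set T -> \bar R}).
- exact: cylinders_measurable.
- by move=> _; exact: cylinders_setT.
- by rewrite -subTset => w _; exists 0%N.
- exact: cylinders_setI.
- move=> _ [s [E [us sD GE ->]]].
  have is_ : i \notin s by apply: contra Di => /sD.
  rewrite /mrestr -[RHS]/((prob P B)%:E * P _)%E -probE// indG// muleC.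
  pose E' j := if j == i then B else E j.
  have e : \bigcap_(j in [set` s]) E j `&` B = \bigcap_(j in [set` i :: s]) E' j.
    apply/seteqP; split => w.
      move=> [h Bw] j /=; rewrite inE /E'; case: eqP => //= _ js; exact: h.
    move=> h; split => [j /= js|]; last first.
      by have := h i; rewrite /= mem_head /E' eqxx; apply.
    have := h j; rewrite /= inE js orbT /E' => /(_ isT).
    by case: eqP => // ji; rewrite ji (negbTE is_) in js.
  rewrite -[LHS]/(P (_ `&` B)) e indG /=; last 2 first.
  + by rewrite is_.
  + by move=> j; rewrite inE /E'; case: eqP => [->//|_ /= /GE].
  rewrite big_cons {1}/E' eqxx muleC; congr (_ * _)%E.
  rewrite !big_seq; apply: eq_bigr => j js; rewrite /E'.
  by case: eqP => // ji; rewrite ji (negbTE is_) in js.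
- by move=> _; rewrite -[X in (X < _)%E]/(P (setT `&` B)) setTI probE// ltry.
Qed.

End Cylinders.

Section Problem.
Context {R : realType} {p : nat -> R} (L : last_success_problem p).
Local Notation P := (Pr L).
Local Notation N := (ntrials L).
Local Notation U := (unif L).
Local Notation X := (outcome L).
Local Notation pr := (prob P).

Definition trial_source (j : option (nat + nat)) : set (set (Omega L)) :=
  match j with
  | None => sigma_of N
  | Some (inl i) => sigma_of (U i)
  | Some (inr k) => sigma_of (X k)
  end.

Lemma sigma_ofP d d' (T : measurableType d) (T' : measurableType d') (f : T -> T') B :
  measurable B -> sigma_of f (f @^-1` B).
Proof. by move=> mB; exists B => //; rewrite setTI. Qed.

Lemma trial_source_sigma_algebra j : sigma_algebra setT (trial_source j).
Proof.
by case: j => [[i|k]|]; apply: sigma_algebra_preimage; exact: sigma_algebra_measurable.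
Qed.

Lemma trial_source_measurable j : trial_source j `<=` measurable.
Proof.
by case: j => [[i|k]|] _ [B mB <-]; exact: measurable_funP.
Qed.

Definition known_before (k : nat) : {pred option (nat + nat)} :=
  fun j => if j is Some (inr i) then (i < k)%N else true.

(** What a player who is told the number of trials and all the epochs in advance
    knows just before the outcome of rank k. *)
Definition info (k : nat) : set (set (Omega L)) :=
  <<s cylinders trial_source (known_before k) >>.

Lemma info_sigma_algebra k : sigma_algebra setT (info k).
Proof. exact: smallest_sigma_algebra. Qed.
#[local] Hint Resolve info_sigma_algebra : core.

Lemma info_measurable k : info k `<=` measurable.
Proof.
apply: smallest_sub; first exact: sigma_algebra_measurable.
by apply: cylinders_measurable; exact: trial_source_measurable.
Qed.

Lemma info_source k j A : j \in known_before k -> trial_source j A -> info k A.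
Proof. by move=> kj jA; apply: sub_sigma_algebra; exact: cylinders_source jA. Qed.

Lemma info_le k l : (k <= l)%N -> info k `<=` info l.
Proof.
move=> kl; apply: smallest_sub => // A [s [E [us sk GE ->]]].
apply: sub_sigma_algebra; exists s, E; split => //.
move=> j /sk; rewrite !unfold_in; case: j => [[i|i]|]//= h; exact: leq_trans kl.
Qed.

Lemma info_ntrials k n : info k [set w | N w = n].
Proof. by apply: (@info_source k None) => //; exact: (@sigma_ofP _ _ _ _ N [set n]). Qed.

Lemma info_unif k i B : measurable B -> info k (U i @^-1` B).
Proof. by move=> mB; apply: (@info_source k (Some (inl i))) => //; exact: sigma_ofP. Qed.

Lemma info_outcome k i e : (i < k)%N -> info k [set w | X i w = e].
Proof.
move=> ik; apply: (@info_source k (Some (inr i))) => //.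
exact: (@sigma_ofP _ _ _ _ (X i) [set e]).
Qed.

Lemma measurable_outcome i : measurable [set w | X i w].
Proof. exact: (@info_measurable i.+1 _ (info_outcome true (ltnSn i))). Qed.

Lemma prob_trial_source (D : {pred option (nat + nat)}) j A B :
  <<s cylinders trial_source D >> A -> j \notin D -> trial_source j B ->
  pr (A `&` B) = pr A * pr B.
Proof.
move=> sA Dj jB.
apply: (@cylinders_independent _ _ _ _ _ trial_source) sA Dj jB.
- by move=> i; apply: sigma_algebraT; exact: trial_source_sigma_algebra.
- by move=> i A' B'; apply: sigma_algebraI; exact: trial_source_sigma_algebra.
- exact: trial_source_measurable.
- exact: all_independent.
Qed.

Lemma prob_outcome k A : info k A -> pr (A `&` [set w | X k w]) = pr A * p k.
Proof.
move=> kA; have -> : p k = pr [set w | X k w] by rewrite /prob outcome_law.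
apply: (@prob_trial_source (known_before k) (Some (inr k))) => //.
  by rewrite unfold_in /= ltnn.
exact: (@sigma_ofP _ _ _ _ (X k) [set true]).
Qed.

Lemma info_outcome_count k d m : info (k + d) [set w | count (X^~ w) (iota k d) = m].
Proof.
(* Only outcomes of rank below k + d are known: the others are replaced by
   failures, which does not change the count. *)
pose Q i w := (i < k + d)%N && X i w.
rewrite (_ : [set w | _] = [set w | count (Q^~ w) (iota k d) = m]).
  apply: sigma_algebra_count_eq => // i.
  rewrite /Q; case: ltnP => /= h; first exact: info_outcome.
  exact: (sigma_algebra_prop (info_sigma_algebra _) false).
apply/seteqP; split => w /= <-; apply: eq_in_count => i; rewrite mem_iota /Q.
  by case/andP => _ ->.
by case/andP => _ ->.
Qed.

Lemma measurable_outcome_count k d m :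
  measurable [set w | count (X^~ w) (iota k d) = m].
Proof. exact: info_measurable (@info_outcome_count k d m). Qed.

Lemma prob_no_success A k d : info k A ->
  pr (A `&` [set w | count (X^~ w) (iota k d) = 0%N]) = pr A * no_success p k d.
Proof.
elim: d k A => [|d IH] k A kA /=.
  by rewrite mulr1 (_ : [set w | _] = setT) ?setIT//; apply/seteqP; split.
rewrite (_ : A `&` _ = (A `\` [set w | X k w]) `&`
    [set w | count (X^~ w) (iota k.+1 d) = 0%N]); last first.
  apply/seteqP; split => w /=.
    by move=> [Aw]; case: (X k w) => //=; rewrite add0n.
  by move=> [[Aw]]; case: (X k w) => //=; rewrite add0n.
have iX := info_outcome true (ltnSn k).
have iA := info_le (leqnSn k) kA.
rewrite IH; last exact: (sigma_algebraD (info_sigma_algebra _)).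
have := @probDI _ _ _ P A [set w | X k w] (info_measurable kA) (measurable_outcome k).
rewrite prob_outcome// => h; rewrite mulrA; congr (_ * _); lra.
Qed.

(** The outcome of rank k is revealed first: both [A `&` F] and [A `\` F] belong
    to [info k.+1], which is what the induction over d needs. *)
Lemma prob_single_success A k d : info k A ->
  pr (A `&` [set w | count (X^~ w) (iota k d) = 1%N]) = pr A * single_success p k d.
Proof.
elim: d k A => [|d IH] k A kA /=.
  rewrite mulr0 (_ : [set w | _] = set0) ?setI0 ?prob_set0//.
  by apply/seteqP; split.
set F := [set w | X k w].
have iX : info k.+1 F := info_outcome true (ltnSn k).
have iA := info_le (leqnSn k) kA.
rewrite (_ : A `&` _ =
  ((A `&` F) `&` [set w | count (X^~ w) (iota k.+1 d) = 0%N]) `|`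
  ((A `\` F) `&` [set w | count (X^~ w) (iota k.+1 d) = 1%N])); last first.
  apply/seteqP; split => w; rewrite /F /=.
    move=> [Aw]; case E: (X k w); rewrite ?add1n ?add0n => h.
      by left; split => //; case: h.
    by right; split => //; split.
  by case=> -[[Aw]]; case: (X k w) => //= _ ->.
have iAF : info k.+1 (A `&` F) by exact: (sigma_algebraI (info_sigma_algebra _)).
have iAD : info k.+1 (A `\` F) by exact: (sigma_algebraD (info_sigma_algebra _)).
rewrite probU; last first.
- by apply/seteqP; split => w //= -[[[_ h] _] [[_ nh] _]].
- apply: measurableI; first exact: info_measurable iAD.
  exact: measurable_outcome_count.
- apply: measurableI; first exact: info_measurable iAF.
  exact: measurable_outcome_count.
rewrite prob_no_success// IH// prob_outcome//.
have := @probDI _ _ _ P A F (info_measurable kA) (measurable_outcome k).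
rewrite prob_outcome// => h.
have -> : pr (A `\` F) = pr A * (1 - p k) by lra.
by ring.
Qed.

End Problem.

(** * Epochs and stopping before an epoch *)

(** Order statistics expressed by counting: a is a lower set such as [<= t] or
    [< b], and the default value x0, which lies outside it, plays the role of
    infinity. *)
Lemma sort_nth_count (R : realDomainType) (a : pred R) (x0 : R) (s : seq R) (k : nat) :
  (forall x y, x <= y -> a y -> a x) -> ~~ a x0 ->
  (~~ a (nth x0 (sort <=%R s) k)) = (count a s <= k)%N.
Proof.
move=> adown a1.
rewrite -(count_sort <=%R a s).
have := sort_le_sorted s.
elim: (sort _ _) k => [|x t IH] k; first by rewrite nth_nil a1.
move=> /= xt; have tx := order_path_min le_trans xt.
have /IH {}IH := path_sorted xt.
case: k => [|k] /=; last first.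
  rewrite IH; case: (boolP (a x)) => [_|nax]; first by rewrite add1n ltnS.
  have -> : count a t = 0%N.
    apply/eqP; rewrite -leqn0 leqNgt -has_count; apply/hasPn => y yt.
    by apply: contra nax; apply: adown; exact: (allP tx).
  by rewrite !leq0n.
case: (boolP (a x)) => [//|nax].
rewrite add0n leqn0 -leqn0 leqNgt -has_count; apply/esym/hasPn => y yt.
by apply: contra nax; apply: adown; exact: (allP tx).
Qed.

Section Epochs.
Context {R : realType} {p : nat -> R} (L : last_success_problem p).
Local Notation P := (Pr L).
Local Notation N := (ntrials L).
Local Notation U := (unif L).
Local Notation X := (outcome L).
Local Notation pr := (prob P).
Local Notation epoch := (epoch L).
Local Notation info := (@info R p L).

Lemma epoch_itv k w : 0 <= epoch k w <= 1.
Proof.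
rewrite /Defs.epoch; set s := [seq _ | _ <- _].
have [ks|ks] := ltnP k (size (sort <=%R s)); last first.
  by rewrite nth_default// ler01 lexx.
have := mem_nth 1 ks; rewrite mem_sort => /mapP[i _ ->].
by have := @unif_itv _ _ L i w; rewrite in_itv.
Qed.

Lemma epoch_gtE t k w : t < 1 ->
  (t < epoch k w) = (count (fun i => (U i w <= t)%R) (iota 0 (N w)) <= k)%N.
Proof.
move=> t1; rewrite -[RHS]/(count (preim (U^~ w) (fun x => x <= t)%R) _ <= k)%N.
rewrite -count_map -(@sort_nth_count _ _ 1) -?ltNge// => x y.
exact: le_trans.
Qed.

Lemma epoch_geE b k w : b <= 1 ->
  (b <= epoch k w) = (count (fun i => (U i w < b)%R) (iota 0 (N w)) <= k)%N.
Proof.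
move=> b1; rewrite -[RHS]/(count (preim (U^~ w) (fun x => x < b)%R) _ <= k)%N.
rewrite -count_map -(@sort_nth_count _ _ 1) -?leNgt// => x y.
exact: le_lt_trans.
Qed.

Lemma epoch_le k l w : (k <= l)%N -> epoch k w <= epoch l w.
Proof.
move=> kl; rewrite leNgt; apply/negP => lk.
have l1 : epoch l w < 1 by apply: lt_le_trans lk _; have /andP[] := epoch_itv k w.
have := ltxx (epoch l w); rewrite epoch_gtE// => /negbT.
by rewrite -ltnNge => h; move: lk; rewrite epoch_gtE// leqNgt (leq_ltn_trans kl).
Qed.

Lemma info_epoch_gt k j t : info k [set w | t < epoch j w].
Proof.
have sk := @info_sigma_algebra _ _ L k.
have [t1|t1] := ltP t 1; last first.
  rewrite (_ : [set w | _] = set0); first exact: sigma_algebra0 sk.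
  apply/seteqP; split => w //=; rewrite ltNge (le_trans _ t1)//.
  by have /andP[] := epoch_itv j w.
rewrite (_ : [set w | _] = \bigcup_n ([set w | N w = n] `&`
   [set w | (count (fun i => (U i w <= t)%R) (iota 0 n) < j.+1)%N])).
  apply: (sigma_algebra_bigcup sk) => n; apply: (sigma_algebraI sk).
    exact: info_ntrials.
  apply: (sigma_algebra_count_lt sk) => i.
  rewrite (_ : [set w | _] = U i @^-1` `]-oo, t]); first exact: info_unif.
  by apply/seteqP; split => w /=; rewrite in_itv.
apply/seteqP; split => w /=; rewrite epoch_gtE//.
  by move=> h; exists (N w).
by move=> [n _ [/= ->]].
Qed.

Lemma info_epoch k j B : measurable B -> info k (epoch j @^-1` B).
Proof.
move=> mB; apply: (sigma_algebra_preimage_real (@info_sigma_algebra _ _ L k)) mB.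
by move=> t; exact: info_epoch_gt.
Qed.

Lemma info_ntrials_gt k n : info k [set w | (n < N w)%N].
Proof.
have sk := @info_sigma_algebra _ _ L k.
rewrite (_ : [set w | _] = \bigcup_m ([set w | N w = m] `&` [set _ | (n < m)%N])).
  apply: (sigma_algebra_bigcup sk) => m; apply: (sigma_algebraI sk).
    exact: info_ntrials.
  exact: sigma_algebra_prop sk _.
by apply/seteqP; split => w /=; [move=> h; exists (N w)|move=> [m _ [/= ->]]].
Qed.

Lemma info_trial_event k j e B : (j < k)%N -> measurable B ->
  info k [set w | [/\ (j < N w)%N, B (epoch j w) & X j w = e]].
Proof.
move=> jk mB; have sk := @info_sigma_algebra _ _ L k.
rewrite (_ : [set w | _] =
  [set w | (j < N w)%N] `&` epoch j @^-1` B `&` [set w | X j w = e]).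
  apply: (sigma_algebraI sk); last exact: info_outcome.
  by apply: (sigma_algebraI sk); [exact: info_ntrials_gt|exact: info_epoch].
by apply/seteqP; split => w /= => [[]|[[]]].
Qed.

Lemma trial_events_measurable t : trial_events L t `<=` measurable.
Proof.
move=> _ [k [e [B [mB _ ->]]]].
exact: info_measurable (info_trial_event e (ltnSn k) mB).
Qed.

(** Before the epoch of rank k, only trials of smaller rank have been seen; so,
    on that event, the history consists of epochs and of outcomes known
    before rank k. *)
Lemma history_trace t k A : history L t A -> info k (A `&` [set w | t < epoch k w]).
Proof.
have sk := @info_sigma_algebra _ _ L k.
have iD := @info_epoch_gt k k t.
apply: (smallest_sub (X := [set A | info k (A `&` [set w | t < epoch k w])])).
  split => /=.
  - by rewrite set0I; exact: sigma_algebra0 sk.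
  - move=> {}A iA; rewrite setTD.
    rewrite (_ : _ `&` _ = [set w | t < epoch k w] `\` (A `&` [set w | t < epoch k w])).
      exact: (sigma_algebraD sk).
    by rewrite setDIr setDv setU0 setIC setDE.
  - by move=> F iF; rewrite setI_bigcupl; exact: (sigma_algebra_bigcup sk).
move=> _ [j [e [B [mB Bt ->]]]] /=.
have [jk|kj] := ltnP j k; last first.
  rewrite (_ : _ `&` _ = set0); first exact: sigma_algebra0 sk.
  apply/seteqP; split => w //= [[_ /Bt]].
  rewrite /= in_itv /= => /andP[_ jt] _ tk.
  by have := epoch_le w kj; rewrite leNgt (le_lt_trans jt).
by apply: (sigma_algebraI sk) => //; exact: info_trial_event.
Qed.

Lemma info_stopped_before (tau : {RV P >-> R}) k : stopping_strategy L tau ->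
  info k [set w | tau w < epoch k w].
Proof.
move=> [tau_val tau_stop].
have sk := @info_sigma_algebra _ _ L k.
have tau0 w : 0 <= tau w.
  by case: (tau_val w) => [[j _ ->]|->//]; have /andP[] := epoch_itv j w.
(* A strict inequality between tau and the epoch is witnessed by a rational
   time q at which tau has stopped and the trial has not yet taken place. *)
pose F (q : rat) : set (Omega L) := [set _ | ratr q \in `[(0:R), 1]] `&`
  ([set w | tau w <= ratr q] `&` [set w | ratr q < epoch k w]).
rewrite (_ : [set w | _] = [set w | exists q, F q w]).
  apply: (sigma_algebra_bigcup_count sk) => q; rewrite /F.
  have [h|h] := boolP (ratr q \in `[(0:R), 1]); last first.
    rewrite (_ : _ `&` _ = set0); first exact: sigma_algebra0 sk.
    by apply/seteqP; split => w //= [].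
  apply: (sigma_algebraI sk); first exact: sigma_algebra_prop sk _.
  by apply: history_trace; exact: tau_stop.
apply/seteqP; split => w /=.
  move=> h; have [q] := rat_in_itvoo h; rewrite in_itv /= => /andP[h1 h2].
  exists q; split => /=; last by split => //=; exact: ltW.
  rewrite in_itv /= (le_trans (tau0 w) (ltW h1)) /=.
  by apply: (le_trans (ltW h2)); have /andP[] := epoch_itv k w.
by move=> [q [_ [/= h1 h2]]]; exact: le_lt_trans h1 h2.
Qed.

End Epochs.

(** * The upper bound for every strategy *)

(** In the application, [b k] is the probability of not having stopped before rank
    k, [a k] that of stopping at a success of rank k, and [q k] that of no later
    success; the left-hand side is then the winning probability. *)
Lemma bellman_bound (R : realFieldType) (n : nat) (a b p q v : nat -> R) :
  (forall k, (k < n)%N -> 0 <= a k <= b k * p k) ->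
  (forall k, (k < n)%N -> b k.+1 <= b k - a k) ->
  (forall k, 0 <= b k) -> 0 <= v n ->
  (forall k, (k < n)%N -> v k.+1 <= v k /\
     p k * q k + (1 - p k) * v k.+1 <= v k) ->
  \sum_(0 <= k < n) a k * q k <= b 0%N * v 0%N.
Proof.
move=> ha hb b0 vn hv.
suff H d : (d <= n)%N -> 0 <= v (n - d)%N /\
    \sum_((n - d)%N <= k < n) a k * q k <= b (n - d)%N * v (n - d)%N.
  by have [_] := H n (leqnn n); rewrite subnn.
elim: d => [_|d IH dn].
  by rewrite subn0 big_geq//; split => //; exact: mulr_ge0.
have [] := IH (ltnW dn).
have kn : (n - d.+1 < n)%N by rewrite ltn_subrL; case: (n) dn.
have -> : (n - d = (n - d.+1).+1)%N by rewrite subnS prednK// subn_gt0.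
set k := (n - d.+1)%N in kn * => v1 hS.
have [vk hk] := hv k kn; have /andP[a0 ak] := ha k kn; have bk := hb k kn.
split; first exact: le_trans v1 vk.
rewrite big_ltn//; apply: (le_trans (lerD (lexx _) hS)).
apply: (@le_trans _ _ (a k * q k + (b k - a k) * v k.+1)).
  by rewrite lerD2l ler_wpM2r.
have e : a k * q k + (b k - a k) * v k.+1 = a k * (q k - v k.+1) + b k * v k.+1 by ring.
(* If stopping is better than continuing, [a k] is replaced by its largest
   possible value; otherwise by 0. *)
rewrite e; have [qv|vq] := leP (v k.+1) (q k).
  apply: (@le_trans _ _ (b k * p k * (q k - v k.+1) + b k * v k.+1)).
    by rewrite lerD2r ler_wpM2r// subr_ge0.
  have -> : b k * p k * (q k - v k.+1) + b k * v k.+1 =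
    b k * (p k * q k + (1 - p k) * v k.+1) by ring.
  by rewrite ler_wpM2l.
apply: (@le_trans _ _ (b k * v k.+1)); last by rewrite ler_wpM2l.
by rewrite gerDr mulr_ge0_le0// subr_le0 ltW.
Qed.

Lemma sort_nth_lt (R : realDomainType) (x0 : R) (s : seq R) (k : nat) :
  uniq s -> (forall x, x \in s -> x < x0) -> (k < size s)%N ->
  nth x0 (sort <=%R s) k < nth x0 (sort <=%R s) k.+1.
Proof.
move=> us s1 ks.
have ks' : (k < size (sort <=%R s))%N by rewrite size_sort.
have [k1|k1] := ltnP k.+1 (size (sort <=%R s)).
  by rewrite (lt_sorted_ltn_nth x0 (s := sort <=%R s))// sort_lt_sorted.
rewrite [X in _ < X]nth_default//; apply: s1.
by have := mem_nth x0 ks'; rewrite mem_sort.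
Qed.

Lemma uniform_prob01_itvco (R : realType) (a c : R) : 0 <= a -> a <= c -> c <= 1 ->
  uniform_prob (@ltr01 R) `[a, c[ = (c - a)%:E.
Proof.
move=> a0 ac c1; rewrite /uniform_prob.
rewrite (eq_integral (fun=> 1%:E)); last first.
  move=> x; rewrite inE /= in_itv /= => /andP[ax xc].
  by rewrite /uniform_pdf (le_trans a0 ax) (le_trans (ltW xc) c1) subr0 invr1.
rewrite integral_cst//= lebesgue_measure_itv/= lte_fin mul1e.
by case: ltgtP ac => // -> _; rewrite subrr.
Qed.

Lemma measurable_eq_fun d (T : measurableType d) (R : realType) (f g : T -> R) :
  measurable_fun setT f -> measurable_fun setT g -> measurable [set w | f w = g w].
Proof.
move=> mf mg.
rewrite (_ : [set w | _] = setT `&` (f \- g)%R @^-1` [set 0]).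
  exact: measurable_funB.
rewrite setTI; apply/seteqP; split => w /=; first by move=> ->; rewrite subrr.
by move=> /eqP; rewrite subr_eq0 => /eqP.
Qed.

Section UpperBound.
Context {R : realType} {p : nat -> R} (L : last_success_problem p).
Local Notation P := (Pr L).
Local Notation N := (ntrials L).
Local Notation U := (unif L).
Local Notation X := (outcome L).
Local Notation pr := (prob P).
Local Notation epoch := (epoch L).
Local Notation info := (@info R p L).

Lemma prob_unif_itvco i (a c : R) : 0 <= a -> a <= c -> c <= 1 ->
  pr (U i @^-1` `[a, c[) = c - a.
Proof. by move=> a0 ac c1; rewrite /prob unif_law// uniform_prob01_itvco. Qed.

Lemma prob_unif2 i j B : i != j -> measurable B ->
  pr (U i @^-1` B `&` U j @^-1` B) = pr (U i @^-1` B) * pr (U j @^-1` B).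
Proof.
move=> ij mB; apply: (@prob_trial_source _ _ L (pred1 (Some (inl i))) (Some (inl j))).
- apply: sub_sigma_algebra; apply: (@cylinders_source _ _ _ _ _ (Some (inl i))).
    by rewrite inE.
  exact: sigma_ofP.
- by rewrite inE /=; apply: contra ij => /eqP[->].
- exact: sigma_ofP.
Qed.

Lemma measurable_unif i B : measurable B -> measurable (U i @^-1` B).
Proof. by move=> mB; rewrite -[X in measurable X]setTI; exact: measurable_funP. Qed.

Lemma prob_unif_eq1 i : pr [set w | U i w = 1] = 0.
Proof.
have := @probC _ _ _ P (U i @^-1` `[0, 1[).
rewrite prob_unif_itvco// subr0 subrr => <-; last exact: measurable_unif.
congr pr; apply/seteqP; split => w /=; have := @unif_itv _ _ L i w; rewrite !in_itv /=.
  by move=> _ ->; rewrite ltxx andbF.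
move=> /andP[-> h] /negP /=; rewrite -leNgt => h'.
by apply/eqP; rewrite eq_le h h'.
Qed.

(** Up to the event that the common value is 1, both variables fall into the same
    one of M cells of length 1 / M, an event of probability at most 1 / M. *)
Lemma prob_unif_eq i j : i != j -> pr [set w | U i w = U j w] = 0.
Proof.
move=> ij; apply/eqP; rewrite eq_le prob_ge0 andbT.
apply/ler_addgt0Pl => e e0; rewrite addr0.
pose M := (Num.trunc e^-1).+1.
have M0 : 0 < M%:R :> R by rewrite ltr0n.
have Me : M%:R^-1 <= e.
  by rewrite -[leRHS]invrK lef_pV2 ?posrE ?invr_gt0// ltW// truncnS_gt.
pose I (m : nat) : set R := `[m%:R / M%:R, m.+1%:R / M%:R[%classic.
pose F (m : nat) := U i @^-1` I m `&` U j @^-1` I m.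
have mF m : measurable (F m) by apply: measurableI; apply: measurable_unif; exact: measurable_itv.
have m1 : measurable [set w | U i w = 1].
  by rewrite (_ : [set w | _] = U i @^-1` [set 1])//; exact: measurable_unif.
have mU : measurable (\big[setU/set0]_(m <- iota 0 M) F m).
  by apply: bigsetU_measurable => m _.
apply: (@le_trans _ _ (pr ([set w | U i w = 1] `|` \big[setU/set0]_(m <- iota 0 M) F m))).
  apply: le_prob; [exact: measurable_eq_fun|exact: measurableU|].
  move=> w /= eij; have := @unif_itv _ _ L i w; rewrite in_itv /= => /andP[u0 u1].
  have [->|un1] := eqVneq (U i w) 1; first by left.
  right; rewrite -bigcup_seq.
  have ul : U i w < 1 by rewrite lt_neqAle un1.
  have uM : 0 <= U i w * M%:R by rewrite mulr_ge0// ltW.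
  have /andP[h1 h2] := truncn_itv uM.
  exists (Num.trunc (U i w * M%:R)).
    suff : Num.trunc (U i w * M%:R) \in iota 0 M by [].
    rewrite mem_iota add0n leq0n -(ltr_nat R).
    by apply: (le_lt_trans h1); rewrite gtr_pMl.
  rewrite /F /I /= -eij !in_itv /=.
  by rewrite ler_pdivrMr// ltr_pdivlMr// h1 h2.
apply: (le_trans (probU_le _ _ _)) => //.
rewrite prob_unif_eq1 add0r; apply: (le_trans (prob_bigU_le _ _ mF)).
apply: le_trans Me.
rewrite big_seq.
apply: (@le_trans _ _ (\sum_(m <- iota 0 M | m \in iota 0 M) (M%:R^-1 * M%:R^-1))).
  apply: ler_sum => m; rewrite mem_iota add0n => /andP[_ mM].
  have mi : measurable (I m) by exact: measurable_itv.
  have h k : pr (U k @^-1` I m) = M%:R^-1.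
    rewrite prob_unif_itvco.
    - by rewrite -mulrBl -(natr1 m) addrAC subrr add0r mul1r.
    - by rewrite divr_ge0.
    - by rewrite ler_pM2r ?invr_gt0// ler_nat.
    - by rewrite ler_pdivrMr// mul1r ler_nat.
  by rewrite /F prob_unif2// !h.
rewrite -big_seq big_const_seq count_predT size_iota iter_addr_0.
by rewrite -[X in X <= _]mulr_natr -mulrA mulVf ?mulr1// gt_eqF.
Qed.

(** The value 1 is the epoch assigned to missing trials, so a trial at time 1 is a
    tie too; the diagonal of the family encodes this case. *)
Definition tie i j : set (Omega L) :=
  if i == j then [set w | U i w = 1] else [set w | U i w = U j w].

Lemma measurable_tie i j : measurable (tie i j).
Proof.
rewrite /tie; case: eqP => _; last exact: measurable_eq_fun.
by rewrite (_ : [set w | _] = U i @^-1` [set 1])//; exact: measurable_unif.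
Qed.

Lemma prob_tie i j : pr (tie i j) = 0.
Proof. by rewrite /tie; case: eqVneq => [_|]; [exact: prob_unif_eq1|exact: prob_unif_eq]. Qed.

Lemma epoch_lt_succ k w :
  (forall i j, (i < N w)%N -> (j < N w)%N -> ~ tie i j w) ->
  (k < N w)%N -> epoch k w < epoch k.+1 w.
Proof.
move=> notie kN; apply: sort_nth_lt; last by rewrite size_map size_iota.
  rewrite map_inj_in_uniq ?iota_uniq// => i j; rewrite !mem_iota /= !add0n => iN jN eij.
  apply/eqP; rewrite -[_ == _]negbK; apply/negP => ij.
  by apply: (notie i j iN jN); rewrite /tie (negbTE ij).
move=> x /mapP[i]; rewrite mem_iota /= add0n => iN ->.
have := @unif_itv _ _ L i w; rewrite in_itv /= => /andP[_ u1].
rewrite lt_neqAle u1 andbT; apply/eqP => e.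
by apply: (notie i i iN iN); rewrite /tie eqxx.
Qed.

(** Links the winning condition with [prob_no_success]. *)
Lemma count_outcome0P k n w :
  (forall j, (k < j < n)%N -> ~~ X j w) <->
  count (X^~ w) (iota k.+1 (n - k.+1)) = 0%N.
Proof.
split=> [h|/eqP].
  apply/eqP; rewrite -leqn0 leqNgt -has_count; apply/hasPn => j.
  by rewrite mem_iota => /andP[kj jn]; apply: h; rewrite kj /=; lia.
rewrite -leqn0 leqNgt -has_count => /hasPn h j /andP[kj jn].
by apply: h; rewrite mem_iota kj; lia.
Qed.

Lemma measurable_epoch k : measurable_fun setT (epoch k).
Proof.
move=> _ B mB; rewrite setTI.
exact: (@info_measurable _ _ L 0 _ (@info_epoch _ _ L 0 k B mB)).
Qed.

Lemma measurable_ntrials n : measurable [set w | N w = n].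
Proof. exact: (@info_measurable _ _ L 0 _ (@info_ntrials _ _ L 0 n)). Qed.

Lemma measurable_wins (tau : Omega L -> R) : measurable_fun setT tau ->
  measurable (wins L tau).
Proof.
move=> mtau.
pose F (x : nat * nat) := [set _ | (x.1 < x.2)%N] `&` [set w | N w = x.2] `&`
  [set w | tau w = epoch x.1 w] `&` [set w | X x.1 w] `&`
  [set w | count (X^~ w) (iota x.1.+1 (x.2 - x.1.+1)) = 0%N].
have sm := @sigma_algebra_measurable _ (Omega L).
rewrite (_ : wins L tau = [set w | exists x, F x w]).
  apply: (sigma_algebra_bigcup_count sm) => x; rewrite /F.
  apply: measurableI; last exact: measurable_outcome_count.
  apply: measurableI; last exact: measurable_outcome.
  apply: measurableI; last by apply: measurable_eq_fun => //; exact: measurable_epoch.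
  apply: measurableI; last exact: measurable_ntrials.
  exact: (sigma_algebra_prop sm).
apply/seteqP; split => w.
  move=> [k [kN tk Xk h]]; exists (k, N w).
  by split; last exact/count_outcome0P.
move=> [[k n] [[[[/= kn] Nn] tk] Xk] h]; exists k; rewrite Nn; split => //.
exact/count_outcome0P.
Qed.

Hypothesis p01 : forall k, 0 <= p k <= 1.
Hypothesis p_lt1 : forall k, p k.+1 < 1.

(** Without ties, stopping at rank k means that tau is below the epoch of rank
    k + 1 but not below that of rank k.  This puts the event [S k] of stopping
    there into [info k.+1], so that the outcomes of larger rank are independent
    of it, and the success at rank k is independent of not having stopped
    before.  Backward induction then applies. *)
Lemma prob_wins_ntrials_le (tau : {RV P >-> R}) (n : nat) (c : R) :
  stopping_strategy L tau ->
  (forall k, (k <= n)%N -> single_success p k (n - k) <= c) ->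
  pr (wins L tau `&` [set w | N w = n]) <= c * pr [set w | N w = n].
Proof.
move=> strat hc.
have [v [v0 vn hv]] := bellman_supersolution p01 p_lt1 hc.
set Nn := [set w | N w = n].
pose C k := [set w | tau w < epoch k w].
have iN k : info k Nn by exact: info_ntrials.
have iC k : info k (C k) by exact: info_stopped_before strat.
have sI k := @info_sigma_algebra _ _ L k.
have CC k : C k `<=` C k.+1.
  by move=> w /= h; apply: lt_le_trans h _; exact: epoch_le.
pose S k := Nn `&` (C k.+1 `\` C k).
have iS k : info k.+1 (S k).
  apply: (sigma_algebraI (sI _)) => //; apply: (sigma_algebraD (sI _)) => //.
  exact: (info_le (leqnSn k)).
pose A k := S k `&` [set w | X k w].
have iA k : info k.+1 (A k).
  by apply: (sigma_algebraI (sI _)) => //; exact: info_outcome.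
pose W k := A k `&` [set w | count (X^~ w) (iota k.+1 (n - k.+1)) = 0%N].
have mW k : measurable (W k).
  by apply: measurableI; [exact: info_measurable (iA k)|exact: measurable_outcome_count].
have iB k : info k (Nn `\` C k) by exact: (sigma_algebraD (sI _)).
have mZ : measurable (\big[setU/set0]_(x <- allpairs pair (iota 0 n) (iota 0 n))
    tie x.1 x.2).
  by apply: bigsetU_measurable => x _; exact: measurable_tie.
have mWU : measurable (\big[setU/set0]_(k <- iota 0 n) W k).
  by apply: bigsetU_measurable => m _.
apply: (@le_trans _ _ (pr (\big[setU/set0]_(k <- iota 0 n) W k `|`
    \big[setU/set0]_(x <- allpairs pair (iota 0 n) (iota 0 n)) tie x.1 x.2))).
  apply: le_prob.
  - apply: measurableI; last exact: measurable_ntrials.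
    by apply: measurable_wins; exact: measurable_funP.
  - exact: measurableU.
  move=> w [[k [kN tk Xk h]] Nw]; rewrite -!bigcup_seq.
  have [[i [j [ilt jlt t]]]|notie] :=
    pselect (exists i j, [/\ (i < n)%N, (j < n)%N & tie i j w]).
    right; exists (i, j) => //=; apply/allpairsP; exists (i, j).
    by rewrite /= !mem_iota.
  left; exists k; first by rewrite /= mem_iota -Nw.
  split; last by rewrite /= -Nw; exact/count_outcome0P.
  split => //; split => //; split; last by rewrite /C /= tk ltxx.
  rewrite /C /= tk; apply: epoch_lt_succ => // i j ilt jlt t.
  by apply: notie; exists i, j; rewrite -Nw.
apply: (le_trans (probU_le _ _ _)) => //.
have -> : pr (\big[setU/set0]_(x <- allpairs pair (iota 0 n) (iota 0 n))
    tie x.1 x.2) = 0.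
  apply/eqP; rewrite eq_le prob_ge0 andbT.
  apply: le_trans (prob_bigU_le _ _ _) _ => [x|]; first exact: measurable_tie.
  by rewrite big1// => x _; exact: prob_tie.
rewrite addr0; apply: (le_trans (prob_bigU_le _ _ mW)).
rewrite (eq_bigr (fun k => pr (A k) * no_success p k.+1 (n - k.+1))); last first.
  by move=> k _; rewrite /W prob_no_success.
have -> : iota 0 n = index_iota 0 n by rewrite /index_iota subn0.
apply: le_trans (@bellman_bound _ n _ (fun k => pr (Nn `\` C k)) p
  (fun k => no_success p k.+1 (n - k.+1)) v _ _ _ vn hv) _.
- move=> k kn; rewrite prob_ge0 /= -prob_outcome//.
  apply: le_prob.
  + exact: info_measurable (iA k).
  + apply: measurableI; [exact: info_measurable (iB k)|exact: measurable_outcome].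
  + by move=> w [[Nw [_ nC]] Xk]; split.
- move=> k kn.
  have mB := info_measurable (iB k); have mS := info_measurable (iS k).
  have := probDI P mB mS.
  have -> : (Nn `\` C k) `\` S k = Nn `\` C k.+1.
    apply/seteqP; split => w.
      by move=> [[Nw nC] nS]; split => // C1; apply: nS.
    by move=> [Nw nC]; split; [split => // /CC|move=> [_ []]].
  have -> : (Nn `\` C k) `&` S k = S k.
    by apply/seteqP; split => w [] // Nw [C1 nC]; split.
  have : pr (A k) <= pr (S k).
    by apply: le_prob => //; [exact: info_measurable (iA k)|move=> w []].
  lra.
- by move=> k; exact: prob_ge0.
have c0 : 0 <= c by have := hc n (leqnn n); rewrite subnn.
apply: (@le_trans _ _ (pr (Nn `\` C 0%N) * c)); first by rewrite ler_wpM2l// prob_ge0.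
rewrite mulrC ler_wpM2l//; apply: le_prob.
- exact: info_measurable (iB 0%N).
- exact: measurable_ntrials.
- by move=> w [].
Qed.

End UpperBound.

(** * Concentration of a number of successes *)

Section Chebyshev.
Context d (T : measurableType d) (R : realType) (P : probability T R).

(** Integrability travels together with the value of the integral, so that
    expectations of linear combinations are computed by composition. *)
Definition expects (f : T -> R) (e : R) : Prop :=
  P.-integrable setT (EFin \o f) /\ (\int[P]_w (f w)%:E = e%:E)%E.

Lemma expects_indic A : measurable A -> expects \1_A (prob P A).
Proof.
move=> mA; split; first exact: integrable_indic.
by rewrite integral_indic// setIT; exact: probE.
Qed.

Lemma expectsD f g a b : expects f a -> expects g b ->
  expects (fun w => f w + g w) (a + b).
Proof.
move=> [fi fe] [gi ge]; split; first exact: (integrableD measurableT fi gi).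
by rewrite integralD_EFin// fe ge -EFinD.
Qed.

Lemma expectsZ k f a : expects f a -> expects (fun w => k * f w) (k * a).
Proof.
move=> [fi fe]; split; first exact: (integrableZl measurableT k fi).
under eq_integral do rewrite EFinM.
by rewrite integralZl// fe -EFinM.
Qed.

Lemma expects0 : expects (fun=> 0) 0.
Proof.
by split; [exact: integrable0|rewrite integral0].
Qed.

Lemma expects_sum (I : Type) (s : seq I) (f : I -> T -> R) (a : I -> R) :
  (forall i, expects (f i) (a i)) ->
  expects (fun w => \sum_(i <- s) f i w) (\sum_(i <- s) a i).
Proof.
move=> h; elim: s => [|i s IH].
  rewrite big_nil (_ : (fun w => _) = fun=> 0); first exact: expects0.
  by apply/funext => w; rewrite big_nil.
rewrite big_cons (_ : (fun w => _) = fun w => f i w + \sum_(i <- s) f i w).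
  exact: expectsD.
by apply/funext => w; rewrite big_cons.
Qed.

Lemma expects_le f g a b : expects f a -> expects g b ->
  (forall w, f w <= g w) -> a <= b.
Proof.
move=> [fi fe] [gi ge] fg; rewrite -lee_fin -fe -ge.
by apply: le_integral => // w _; rewrite lee_fin.
Qed.

(** Chebyshev's inequality on the event D.  The square of the centred count is a
    sum of terms indexed by pairs; pairwise independence kills those off the
    diagonal, and each diagonal term contributes b (1 - b). *)
Lemma chebyshev_count (D : set T) (Q : nat -> T -> bool) (b c : R) (n : nat) :
  measurable D -> (forall i, measurable [set w | Q i w]) -> 0 <= c ->
  (forall i, prob P (D `&` [set w | Q i w]) = b * prob P D) ->
  (forall i j, i != j ->
     prob P (D `&` [set w | Q i w] `&` [set w | Q j w]) = b ^+ 2 * prob P D) ->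
  c ^+ 2 * prob P (D `&` [set w | c <= `|(count (Q^~ w) (iota 0 n))%:R - n%:R * b|])
    <= n%:R * (b * (1 - b)) * prob P D.
Proof.
move=> mD mQ c0 h1 h2.
pose A i := [set w | Q i w].
have mA i : measurable (A i) := mQ i.
have hA i : prob P (D `&` A i) = b * prob P D := h1 i.
have hAA i j : i != j -> prob P (D `&` A i `&` A j) = b ^+ 2 * prob P D := h2 i j.
have mDA i : measurable (D `&` A i) := measurableI _ _ mD (mA i).
pose term i j w : R := \1_(D `&` A i `&` A j) w + - b * \1_(D `&` A i) w +
  (- b * \1_(D `&` A j) w + b ^+ 2 * \1_D w).
have termE i j : expects (term i j) (prob P (D `&` A i `&` A j) +
   - b * prob P (D `&` A i) + (- b * prob P (D `&` A j) + b ^+ 2 * prob P D)).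
  apply: expectsD; first apply: expectsD.
  - by apply: expects_indic; exact: measurableI.
  - exact/expectsZ/expects_indic.
  by apply: expectsD; exact/expectsZ/expects_indic.
have termW i j w : term i j w = \1_D w * ((Q i w)%:R - b) * ((Q j w)%:R - b).
  rewrite /term !indicE !in_setI.
  have AE k : (w \in A k) = Q k w by apply/idP/idP; rewrite inE.
  rewrite !AE.
  by case: (w \in D); case: (Q i w); case: (Q j w); rewrite /=; ring.
have sumE := expects_sum (iota 0 n) (fun i => expects_sum (iota 0 n) (termE i)).
have mbad : measurable (D `&` [set w | c <= `|(count (Q^~ w) (iota 0 n))%:R - n%:R * b|]).
  apply: measurableI => //.
  rewrite (_ : [set w | _] = \bigcup_m ([set w | count (Q^~ w) (iota 0 n) = m] `&`
     [set _ | c <= `|m%:R - n%:R * b|])).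
    apply: bigcup_measurable => m _; apply: measurableI.
      by apply: (sigma_algebra_count_eq (@sigma_algebra_measurable _ _)).
    exact: (sigma_algebra_prop (@sigma_algebra_measurable _ _)).
  apply/seteqP; split => w /=; first by eexists.
  by move=> [m _ [/= ->]].
have lhsE := expectsZ (c ^+ 2) (expects_indic mbad).
apply: (le_trans (expects_le lhsE sumE _)) => [w|]; last first.
  rewrite le_eqVlt; apply/orP; left; apply/eqP.
  rewrite (eq_big_seq (fun=> b * (1 - b) * prob P D)) => [|i iin].
    by rewrite big_const_seq count_predT size_iota iter_addr_0 -[LHS]mulr_natl mulrA.
  rewrite (bigD1_seq i) ?iota_uniq//= big1 => [|j ji].
    by rewrite -(setIA D) setIid !hA; ring.
  by rewrite hAA 1?eq_sym// !hA; ring.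
have -> : \sum_(i <- iota 0 n) \sum_(j <- iota 0 n) term i j w =
    \1_D w * ((count (Q^~ w) (iota 0 n))%:R - n%:R * b) ^+ 2.
  have -> : (count (Q^~ w) (iota 0 n))%:R - n%:R * b =
      \sum_(i <- iota 0 n) ((Q i w)%:R - b).
    rewrite sumrB big_const_seq count_predT size_iota iter_addr_0 -[b *+ n]mulr_natl.
    congr (_ - _); rewrite -sum1_count natr_sum [RHS]big_mkcond/= big_mkcond/=.
    by apply: eq_bigr => i _; case: (Q i w).
  rewrite expr2 mulr_suml mulr_sumr; apply: eq_bigr => i _.
  rewrite !mulr_sumr; apply: eq_bigr => j _; rewrite termW; ring.
rewrite !indicE in_setI; case: (boolP (w \in D)) => wD /=; last by rewrite mulr0 mul0r.
rewrite mul1r; case: (boolP (w \in _)); rewrite ?mulr0 ?sqr_ge0//.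
rewrite inE /= mulr1 => h.
by rewrite -[leRHS]real_normK ?num_real// ler_sqr ?nnegrE.
Qed.

End Chebyshev.

(** * The strategy with a single cutoff *)

Section SingleCutoff.
Context {R : realType} {p : nat -> R} (L : last_success_problem p) (b : R).
Hypotheses (b0 : 0 <= b) (b1 : b < 1).
Local Notation P := (Pr L).
Local Notation N := (ntrials L).
Local Notation U := (unif L).
Local Notation X := (outcome L).
Local Notation pr := (prob P).
Local Notation epoch := (epoch L).
Local Notation info := (@info R p L).
Local Notation sc := (single_cutoff L b).

Let qualifies w k := X k w && (b <= epoch k w).

Lemma single_cutoffP w k : (k < N w)%N -> X k w -> b <= epoch k w ->
  exists j, [/\ (j <= k)%N, (j < N w)%N, sc w = epoch j w, X j w & b <= epoch j w].
Proof.
move=> kN Xk bk.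
have hq : has (qualifies w) (iota 0 (N w)).
  by apply/hasP; exists k; [rewrite mem_iota|rewrite /qualifies Xk].
have jN := hq; rewrite has_find size_iota in jN.
have := nth_find 0%N hq; rewrite nth_iota// add0n => /andP[Xj bj].
exists (find (qualifies w) (iota 0 (N w))); split => //.
rewrite leqNgt; apply/negP => kj.
by have := before_find 0%N kj; rewrite nth_iota// add0n /qualifies Xk bk.
Qed.

Lemma single_cutoff_leP t w : t < 1 -> sc w <= t <->
  exists k, [/\ (k < N w)%N, X k w & b <= epoch k w <= t].
Proof.
move=> t1; split => [|[k [kN Xk /andP[bk kt]]]]; last first.
  have [j [jk _ -> _ _]] := single_cutoffP kN Xk bk.
  by apply: le_trans kt; exact: epoch_le.
rewrite /single_cutoff -/(qualifies w).
have [hq|] := boolP (has (qualifies w) (iota 0 (N w))).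
  have jN := hq; rewrite has_find size_iota in jN.
  have := nth_find 0%N hq; rewrite nth_iota// add0n => /andP[Xj bj] jt.
  by exists (find (qualifies w) (iota 0 (N w))); rewrite bj.
move=> /hasNfind ->; rewrite size_iota /Defs.epoch nth_default; last first.
  by rewrite size_sort size_map size_iota.
by rewrite leNgt t1.
Qed.

Lemma history_single_cutoff t : t \in `[0, 1] -> history L t [set w | sc w <= t].
Proof.
rewrite in_itv /= => /andP[t0 t1].
have sH : sigma_algebra setT (history L t) by exact: smallest_sigma_algebra.
have [t1'|t1'] := ltP t 1; last first.
  rewrite (_ : [set w | _] = setT); first exact: sigma_algebraT sH.
  apply/seteqP; split => w //= _; apply: le_trans t1'.
  by have /andP[] := epoch_itv (find (qualifies w) (iota 0 (N w))) w.
rewrite (_ : [set w | _] =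
  \bigcup_k [set w | [/\ (k < N w)%N, `[b, t]%classic (epoch k w) & X k w = true]]).
  apply: (sigma_algebra_bigcup sH) => k; apply: sub_sigma_algebra.
  exists k, true, `[b, t]%classic; split => //.
  by move=> x /=; rewrite !in_itv /= => /andP[/(le_trans b0) -> ->].
apply/seteqP; split => w /=.
  by move=> /(single_cutoff_leP w t1') [k [kN Xk bt]]; exists k => //; split.
move=> [k _ [kN bt Xk]]; apply/(single_cutoff_leP w t1').
by exists k; move: bt; rewrite /= in_itv.
Qed.

Lemma measurable_single_cutoff : measurable_fun setT sc.
Proof.
move=> _ B mB; rewrite setTI.
have sm := @sigma_algebra_measurable _ (Omega L).
apply: (sigma_algebra_preimage_real sm) mB => t.
have sc01 w : 0 <= sc w <= 1 by exact: epoch_itv.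
have [t0|t0] := ltP t 0.
  rewrite (_ : [set w | _] = setT)//; apply/seteqP; split => w //= _.
  by apply: lt_le_trans t0 _; have /andP[] := sc01 w.
have [t1|t1] := leP t 1; last first.
  rewrite (_ : [set w | _] = set0)//; apply/seteqP; split => w //=.
  by rewrite ltNge (le_trans _ (ltW t1))//; have /andP[] := sc01 w.
rewrite (_ : [set w | _] = ~` [set w | sc w <= t]); last first.
  by apply/seteqP; split => w /=; rewrite ltNge => /negP.
apply: measurableC.
have : history L t `<=` measurable.
  by apply: smallest_sub => //; exact: trial_events_measurable.
by apply; apply: history_single_cutoff; rewrite in_itv /= t0.
Qed.

Definition single_cutoff_rv : {RV P >-> R} := mfun_Sub (mem_set measurable_single_cutoff).

Lemma single_cutoff_strategy : stopping_strategy L single_cutoff_rv.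
Proof.
split => [w|t]; last exact: history_single_cutoff.
have [kN|kN] := ltnP (find (qualifies w) (iota 0 (N w))) (N w).
  by left; exists (find (qualifies w) (iota 0 (N w))).
by right; rewrite /= /single_cutoff /Defs.epoch nth_default// size_sort size_map size_iota.
Qed.

(** The ranks at least j are those whose epochs are at least b; if exactly one of
    these trials is a success, the strategy stops there and no success
    follows. *)
Lemma single_cutoff_wins w j :
  count (fun i => U i w < b) (iota 0 (N w)) = j ->
  count (X^~ w) (iota j (N w - j)) = 1%N -> wins L sc w.
Proof.
move=> hJ h1.
have bE k : (b <= epoch k w) = (j <= k)%N by rewrite epoch_geE ?hJ// ltW.
have /hasP[k0 k0in Xk0] : has (X^~ w) (iota j (N w - j)) by rewrite has_count h1.
have k0N : (k0 < N w)%N by move: k0in; rewrite mem_iota; lia.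
have jk0 : (j <= k0)%N by move: k0in; rewrite mem_iota; lia.
have [k [_ kN sck Xk bk]] : exists k, [/\ (k <= k0)%N, (k < N w)%N, sc w = epoch k w,
    X k w & b <= epoch k w] by apply: single_cutoffP => //; rewrite bE.
exists k; split => //; rewrite bE in bk.
have e : (N w - j = (k - j) + (1 + (N w - k.+1)))%N by lia.
move: h1; rewrite e !iotaD !count_cat subnKC//= Xk addn1.
move=> h; apply/count_outcome0P; lia.
Qed.

(** Given n trials, let J be the number of epochs below b.  If J / n is within
    delta of b, then the conditional probability of winning given J is at least
    g, because J is known before every outcome and [single_cutoff_wins] applies;
    the remaining event is bounded by Chebyshev's inequality. *)
Lemma prob_single_cutoff_loses_le (n : nat) (delta g : R) :
  (0 < n)%N -> 0 < delta -> g <= 1 ->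
  (forall k, (k <= n)%N -> `|k%:R - n%:R * b| < n%:R * delta ->
     g <= single_success p k (n - k)) ->
  pr (~` wins L sc `&` [set w | N w = n]) <=
    (1 - g + (n%:R * delta ^+ 2)^-1) * pr [set w | N w = n].
Proof.
move=> n0 d0 g1 hg.
have n0' : 0 < n%:R :> R by rewrite ltr0n.
set Nn := [set w | N w = n].
have mN : measurable Nn by exact: measurable_ntrials.
pose Q i w := U i w < b.
(* The variables are nonnegative, so an interval starting at 0 suffices. *)
have QE i : [set w | Q i w] = U i @^-1` `[0, b[.
  apply/seteqP; split => w /=; have := @unif_itv _ _ L i w; rewrite !in_itv /=.
    by move=> /andP[-> _].
  by move=> _ /andP[].
have mI : measurable (`[0, b[%classic : set R) by exact: measurable_itv.
have mQ i : measurable [set w | Q i w] by rewrite QE; exact: measurable_unif.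
have prQ i : pr [set w | Q i w] = b by rewrite QE prob_unif_itvco ?subr0// ltW.
have sN : trial_source None Nn by exact: (@sigma_ofP _ _ _ _ N [set n]).
have sQ i : trial_source (Some (inl i)) [set w | Q i w] by rewrite QE; exact: sigma_ofP.
have h1 i : pr (Nn `&` [set w | Q i w]) = b * pr Nn.
  rewrite (@prob_trial_source _ _ L (pred1 None) (Some (inl i)))// ?prQ 1?mulrC//.
  by apply: sub_sigma_algebra; apply: cylinders_source sN; rewrite inE.
have h2 i j : i != j -> pr (Nn `&` [set w | Q i w] `&` [set w | Q j w]) = b ^+ 2 * pr Nn.
  move=> ij; rewrite (@prob_trial_source _ _ L (pred2 None (Some (inl i))) (Some (inl j)))//.
  - by rewrite h1 prQ; ring.
  - have sc' : sigma_algebra setT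
        <<s cylinders (@trial_source R p L) (pred2 None (Some (inl i))) >>.
      exact: smallest_sigma_algebra.
    apply: (sigma_algebraI sc'); apply: sub_sigma_algebra.
      by apply: cylinders_source sN; rewrite inE.
    by apply: cylinders_source (sQ i); rewrite inE eqxx orbT.
  - by rewrite !inE /=; apply: contra ij => /eqP[->].
pose J w := count (Q^~ w) (iota 0 n).
pose bad := [set w | n%:R * delta <= `|(J w)%:R - n%:R * b|].
have mJ m : measurable [set w | J w = m].
  by apply: (sigma_algebra_count_eq (@sigma_algebra_measurable _ _)).
have mbad : measurable bad.
  rewrite (_ : bad = \bigcup_m ([set w | J w = m] `&`
     [set _ | n%:R * delta <= `|m%:R - n%:R * b|])).
    apply: bigcup_measurable => m _; apply: measurableI => //.
    exact: (sigma_algebra_prop (@sigma_algebra_measurable _ _)).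
  apply/seteqP; split => w /=; first by exists (J w).
  by move=> [m _ [/= <-]].
have hbad : pr (Nn `&` bad) <= (n%:R * delta ^+ 2)^-1 * pr Nn.
  have := @chebyshev_count _ _ _ P Nn Q b (n%:R * delta) n mN mQ _ h1 h2.
  rewrite -/bad => /(_ (mulr_ge0 (ltW n0') (ltW d0))) h.
  have bb : b * (1 - b) <= 1 by have := b0; have := b1; nra.
  have {}h : (n%:R * delta) ^+ 2 * pr (Nn `&` bad) <= n%:R * pr Nn.
    apply: (le_trans h); rewrite ler_wpM2r ?prob_ge0// ler_piMr// ltW.
  have d2 : 0 < n%:R * delta ^+ 2 by rewrite mulr_gt0// exprn_gt0.
  rewrite ler_pdivlMl// -(ler_pM2l n0'); apply: le_trans h.
  by rewrite exprMn expr2 -!mulrA.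
have mW : measurable (~` wins L sc).
  by apply: measurableC; apply: measurable_wins; exact: measurable_single_cutoff.
pose A := ~` wins L sc `&` Nn `\` bad.
have mA : measurable A by apply: measurableD => //; exact: measurableI.
have hA : pr A <= (1 - g) * pr Nn.
  apply: (@prob_by_value _ _ _ P J) => //; first by rewrite subr_ge0.
  move=> j; have pr0 := prob_ge0 P (Nn `&` [set w | J w = j]).
  have [jn|jn] := ltnP n j.
    rewrite (_ : A `&` _ = set0); last first.
      apply/seteqP; split => w //= [_ Jj].
      by have := count_size (Q^~ w) (iota 0 n); rewrite -/(J w) Jj size_iota leqNgt jn.
    by rewrite prob_set0 mulr_ge0// subr_ge0.
  have [jd|jd] := ltP `|j%:R - n%:R * b| (n%:R * delta); last first.
    rewrite (_ : A `&` _ = set0); last first.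
      by apply/seteqP; split => w //= [[_ nb] Jj]; apply: nb; rewrite /bad /= Jj.
    by rewrite prob_set0 mulr_ge0// subr_ge0.
  have hs := hg j jn jd.
  set G := Nn `&` [set w | J w = j].
  have iG : info j G.
    have sI := @info_sigma_algebra _ _ L j.
    apply: (sigma_algebraI sI); first exact: info_ntrials.
    apply: (sigma_algebra_count_eq sI) => i; rewrite -/(Q i) QE; exact: info_unif.
  have mG := info_measurable iG.
  pose F := [set w | count (X^~ w) (iota j (n - j)) = 1%N].
  have mF : measurable F by exact: measurable_outcome_count.
  apply: (@le_trans _ _ (pr (G `\` F))).
    apply: le_prob; [exact: measurableI|exact: measurableD|].
    move=> w [[[nw Nw] _] Jj]; split => // Fw; apply: nw.
    by apply: (@single_cutoff_wins w j); rewrite Nw.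
  have := probDI P mG mF; rewrite prob_single_success// => e.
  by have : g * pr G <= pr G * single_success p j (n - j); [rewrite mulrC ler_wpM2l|lra].
apply: (@le_trans _ _ (pr (A `|` (Nn `&` bad)))).
  apply: le_prob; [exact: measurableI|by apply: measurableU => //; exact: measurableI|].
  move=> w [nw Nw]; have [wb|wb] := pselect (bad w); first by right.
  by left.
apply: le_trans (probU_le _ mA (measurableI _ _ mN mbad)) _.
by rewrite [leRHS]mulrDl lerD.
Qed.

End SingleCutoff.

(** * Averaging over the number of trials *)

Lemma cvg_EFin_near (R : realType) (u : nat -> \bar R) (l : R) :
  (forall eps, 0 < eps -> \forall m \near \oo,
     ((l - eps)%:E <= u m <= (l + eps)%:E)%E) ->
  u @ \oo --> l%:E.
Proof.
move=> h; apply/fine_cvgP; split.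
  have := h 1 ltr01; apply: filterS => m /andP[h1 h2].
  by rewrite fin_numE; apply/andP; split; apply/eqP => e; rewrite e in h1 h2.
apply/cvgrPdist_le => eps e0; have := h eps e0; apply: filterS => m; rewrite /=.
case: (u m) => [r| |] /andP[] //=; rewrite !lee_fin => h1 h2.
by rewrite ler_norml; apply/andP; split; lra.
Qed.

Section Averaging.
Context {R : realType} {p : nat -> R} (L : last_success_problem p).
Local Notation P := (Pr L).
Local Notation N := (ntrials L).
Local Notation pr := (prob P).

(** A bound that holds given each number of trials beyond K holds on average, up to
    the probability of at most K trials. *)
Lemma prob_le_tail (A : set (Omega L)) (c : R) (K : nat) : 0 <= c -> measurable A ->
  (forall n, (K < n)%N -> pr (A `&` [set w | N w = n]) <= c * pr [set w | N w = n]) ->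
  pr A <= c + pr [set w | (N w <= K)%N].
Proof.
move=> c0 mA h.
have mK : measurable [set w | (N w <= K)%N].
  rewrite (_ : [set w | _] = ~` [set w | (K < N w)%N]).
    by apply: measurableC; exact: (@info_measurable _ _ L 0 _ (@info_ntrials_gt _ _ L 0 K)).
  by apply/seteqP; split => w /=; [move=> NK; apply/negP|move=> /negP]; rewrite -leqNgt.
have mD := measurableD mA mK.
have mI := measurableI _ _ mA mK.
rewrite (probDI P mA mK); apply: lerD; last first.
  by apply: le_prob => // w [].
rewrite -[leRHS]mulr1 -(prob_setT P).
apply: (@prob_by_value _ _ _ P N) => //.
- by move=> n; exact: measurable_ntrials.
move=> n; rewrite setTI.
have mn := @measurable_ntrials _ _ L n.
have [nK|Kn] := leqP n K.
  rewrite (_ : _ `&` _ = set0) ?prob_set0 ?mulr_ge0 ?prob_ge0//.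
  by apply/seteqP; split => w //= [[_ nNK] Nn]; apply: nNK; rewrite /= Nn.
apply: le_trans (h n Kn); apply: le_prob; try exact: measurableI.
by move=> w [[]].
Qed.

End Averaging.

Theorem proposition8 (R : realType) (theta : R) (theta_gt0 : 0 < theta)
    (L : nat -> last_success_problem (theta_profile theta))
    (L_infty : tends_to_infinity_in_probability L) :
  ((fun m => Pr (L m) (wins (L m) (single_cutoff (L m) (expR (- (1 / theta))))))
     @ \oo --> (expR (- 1))%:E) /\
  ((fun m => optimal_win_prob (L m)) @ \oo --> (expR (- 1))%:E).
Proof.
set b := expR (- (1 / theta)).
have b0 : 0 <= b by exact: expR_ge0.
have b1 : b < 1.
  by rewrite -[ltRHS]expR0 ltr_expR oppr_lt0 divr_gt0.
have p01 := theta_profile01 theta_gt0.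
have p_lt1 := theta_profile_lt1 theta_gt0.
have e1 : expR (-1) <= 1 :> R by rewrite -[leRHS]expR0 ler_expR lerN10.
have mwins m : measurable (wins (L m) (single_cutoff (L m) b)).
  by apply: measurable_wins; exact: measurable_single_cutoff.
have upper eps : 0 < eps -> \forall m \near \oo,
    (optimal_win_prob (L m) <= (expR (-1) + eps)%:E)%E.
  move=> eps0; have eps2 : 0 < eps / 2 by rewrite divr_gt0.
  have [K hK] := single_success_le_eventually theta_gt0 eps2.
  have c0 : 0 <= expR (-1) + eps / 2 by rewrite addr_ge0 ?expR_ge0// ltW.
  have /fine_cvgP[_ /cvgrPdist_lt/(_ _ eps2)] := L_infty K.
  apply: filterS => m; rewrite sub0r normrN ger0_norm ?prob_ge0// => hm.
  apply: ge_ereal_sup => _ [tau strat <-].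
  have mw : measurable (wins (L m) tau) by apply: measurable_wins; exact: measurable_funP.
  rewrite probE// lee_fin; apply: (le_trans (@prob_le_tail _ _ (L m) _ _ K c0 mw _)).
    move=> n Kn; apply: prob_wins_ntrials_le => // k kn.
    by apply: hK => //; exact: ltnW.
  by have : prob (Pr (L m)) [set w | (ntrials (L m) w <= K)%N] < eps / 2 by []; lra.
have lower eps : 0 < eps -> \forall m \near \oo,
    ((expR (-1) - eps)%:E <= Pr (L m) (wins (L m) (single_cutoff (L m) b)))%E.
  move=> eps0; have eps3 : 0 < eps / 3 by rewrite divr_gt0.
  have [delta d0 [K0 hK0]] := single_success_ge_eventually theta_gt0 eps3.
  (* From n = M on, the Chebyshev error is at most eps / 3; the other two thirds
     of eps go to [single_success] and to the event of few trials. *)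
  pose M := ((eps / 3) * delta ^+ 2)^-1.
  have d2 : 0 < eps / 3 * delta ^+ 2 by rewrite mulr_gt0// exprn_gt0.
  pose K := maxn K0 (Num.trunc M).+1.
  have c0 : 0 <= 1 - (expR (-1) - eps / 3) + eps / 3 by lra.
  have /fine_cvgP[_ /cvgrPdist_lt/(_ _ eps3)] := L_infty K.
  apply: filterS => m; rewrite sub0r normrN ger0_norm ?prob_ge0// => hm.
  have hm' : prob (Pr (L m)) [set w | (ntrials (L m) w <= K)%N] < eps / 3 by [].
  rewrite probE// lee_fin.
  have := @prob_le_tail _ _ (L m) _ _ K c0 (measurableC (mwins m)).
  rewrite probC// => H; suff : forall n, (K < n)%N ->
    prob (Pr (L m)) (~` wins (L m) (single_cutoff (L m) b) `&` [set w | ntrials (L m) w = n])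
    <= (1 - (expR (-1) - eps / 3) + eps / 3) * prob (Pr (L m)) [set w | ntrials (L m) w = n].
    by move=> /H; lra.
  move=> n Kn.
  have K0n : (K0 <= n)%N by apply: leq_trans (ltnW Kn); exact: leq_maxl.
  have Mn : M <= n%:R.
    apply: (le_trans (ltW (truncnS_gt M))); rewrite ler_nat.
    by apply: leq_trans (ltnW Kn); exact: leq_maxr.
  have n0 : (0 < n)%N by exact: leq_ltn_trans Kn.
  have n0' : 0 < n%:R :> R by rewrite ltr0n.
  apply: (le_trans (@prob_single_cutoff_loses_le _ _ (L m) b b0 b1 n delta
    (expR (-1) - eps / 3) n0 d0 _ _)).
  - by lra.
  - by move=> k kn hk; exact: hK0.
  rewrite ler_wpM2r ?prob_ge0// lerD2l.
  rewrite -[leRHS]invrK lef_pV2 ?posrE ?invr_gt0 ?mulr_gt0// ?exprn_gt0//.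
  have -> : (eps / 3)^-1 = M * delta ^+ 2.
    by rewrite /M; field; rewrite !gt_eqF.
  by rewrite ler_wpM2r// sqr_ge0.
have opt m : (Pr (L m) (wins (L m) (single_cutoff (L m) b)) <= optimal_win_prob (L m))%E.
  apply: ereal_sup_ubound; exists (@single_cutoff_rv _ _ (L m) b b0) => //.
  exact: single_cutoff_strategy.
split; apply: cvg_EFin_near => eps eps0.
  apply: filterS2 (upper eps eps0) (lower eps eps0) => m hu hl.
  by rewrite hl (le_trans (opt m)).
apply: filterS2 (upper eps eps0) (lower eps eps0) => m hu hl.
by rewrite hu andbT (le_trans hl).
Qed.
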